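(* (a) Nonemptiness of $\Sigma^{LSU(1,1)_{(n)}}_w$ does not imply that $w\in W$ is represented by a loop in $SU(1,1)$; for example, $\Sigma^{LSU(1,1)_{(1)}}_{r_1}$ is nonempty (while $r_1$ is not represented by a loop with values in $SU(1,1)$). (b) $\Sigma^{LSU(1,1)_{(0)}}_1$ is properly contained in $LSU(1,1)_{(0)}$.
   Context: $LSL(2,\mathbb C)=C^\infty(S^1,SL(2,\mathbb C))$ and $LSU(1,1)=C^\infty(S^1,SU(1,1))$, with $SU(1,1)=\{\begin{pmatrix} a&b\\ \bar b&\bar a\end{pmatrix}:|a|^2-|b|^2=1\}$. For $n\in\mathbb Z$, $LSU(1,1)_{(n)}$ is the connected component of $LSU(1,1)$ containing the loop $z\mapsto\mathrm{diag}(z^n,z^{-n})$. $W$ is the affine Weyl group $$W=\left\{\mathbf w=\begin{pmatrix} z^n&0\\0&z^{-n}\end{pmatrix}\begin{pmatrix}0&-1\\1&0\end{pmatrix}^{\epsilon}: n\in\mathbb Z,\ \epsilon\in\mathbb Z_4\right\}\Big/\{\pm 1\},$$ and $r_1=\left[\begin{pmatrix}0&-1\\1&0\end{pmatrix}\right]$. An element $w\in W$ is represented by a loop in $SU(1,1)$ if some loop $\mathbf w=\begin{pmatrix} z^n&0\\0&z^{-n}\end{pmatrix}\begin{pmatrix}0&-1\\1&0\end{pmatrix}^{\epsilon}$, with $n\in\mathbb Z$, $\epsilon\in\mathbb Z_4$ and $[\mathbf w]=w$, takes values in $SU(1,1)$, i.e. $w=[\mathrm{diag}(z^n,z^{-n})]$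 for some $n$. For $w=[\mathbf w]\in W$, $\Sigma^{LSL(2,\mathbb C)}_w$ is the set of $g\in LSL(2,\mathbb C)$ having a (Birkhoff) factorization $g=l\,\mathbf w\,m\,a\,u$, where $l$ is a holomorphic map from the open unit disk $\Delta^*$ at $\infty$ to $SL(2,\mathbb C)$ with smooth boundary values on $S^1$ and $l(\infty)$ lower triangular unipotent, $m=\mathrm{diag}(m_0,m_0^{-1})$ with $|m_0|=1$, $a=\mathrm{diag}(a_0,a_0^{-1})$ with $a_0>0$, and $u$ is a holomorphic map from the open unit disk $\Delta$ to $SL(2,\mathbb C)$ with smooth boundary values on $S^1$ and $u(0)$ upper triangular unipotent. Finally $\Sigma^{LSU(1,1)_{(n)}}_w=\Sigma^{LSL(2,\mathbb C)}_w\cap LSU(1,1)_{(n)}$. *)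

(* Defs.v *)
From HB Require Import structures.
From mathcomp Require Import all_boot all_order all_algebra.
From mathcomp Require Export complex.
From mathcomp Require Export all_classical all_reals all_analysis.

Set Implicit Arguments.
Unset Strict Implicit.
Unset Printing Implicit Defensive.

Import Order.TTheory GRing.Theory Num.Theory.
Import numFieldNormedType.Exports.

Local Open Scope classical_set_scope.
Local Open Scope ring_scope.
Local Open Scope complex_scope.

Section LoopGroups.
Variable R : realType.

(* [R[i]] carries the algebra; its topology and normed structure over itself
   live on the convertible alias [R[i]^o]. *)

Definition circle : Type := {z : R[i] | `|z| == 1}.

Fact cis_subproof (t : R) : `|cos t +i* sin t| == 1 :> R[i].
Proof. by rewrite normc_def /= cos2Dsin2 sqrtr1. Qed.

Definition cis (t : R) : circle := exist _ (cos t +i* sin t) (cis_subproof t).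

Definition mx2 (a b c d : R[i]) : 'M[R[i]]_2 :=
  \matrix_(i < 2, j < 2)
    if i == 0 then (if j == 0 then a else b) else (if j == 0 then c else d).

Definition loop : Type := circle -> 'M[R[i]]_2.

Definition re_entry (g : loop) (i j : 'I_2) (t : R) : R :=
  complex.Re (g (cis t) i j).
Definition im_entry (g : loop) (i j : 'I_2) (t : R) : R :=
  complex.Im (g (cis t) i j).

Definition smooth (f : R -> R) : Prop :=
  forall (k : nat) (t : R), derivable (derive1n k f) t 1.

Definition smooth_loop (g : loop) : Prop :=
  forall i j : 'I_2, smooth (re_entry g i j) /\ smooth (im_entry g i j).

Definition LSL2C : set loop :=
  [set g | smooth_loop g /\ forall z, \det (g z) = 1].

Definition SU11 : set 'M[R[i]]_2 :=
  [set A | exists a b : R[i],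
    `|a| ^+ 2 - `|b| ^+ 2 = 1 /\ A = mx2 a b (b^*) (a^*)].

Definition LSU11 : set loop :=
  [set g | smooth_loop g /\ forall z, SU11 (g z)].

(* The k-th derivative with respect to the angle; meaningful on smooth loops. *)
Definition loop_jet (g : loop) : {ptws nat -> {uniform R -> 'M[R[i]^o]_2}} :=
  fun (k : nat) (t : R) =>
    \matrix_(i < 2, j < 2)
      ((derive1n k (re_entry g i j) t +i* derive1n k (im_entry g i j) t) : R[i]^o).

(* The C^oo topology: uniform convergence of every angular derivative. *)
Definition Coo_loop : topologicalType := initial_topology loop_jet.

Definition diag_loop (n : int) : loop :=
  fun z => mx2 (val z ^ n) 0 0 (val z ^ (- n)).

Definition LSU11_component (n : int) : set loop :=
  @connected_component Coo_loop LSU11 (diag_loop n).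

Definition rot : 'M[R[i]]_2 := mx2 0 (-1) 1 0.

Definition weyl_loop (n : int) (eps : 'Z_4) : loop :=
  fun z => diag_loop n z *m rot ^+ (eps : nat).

(* The elements of W are classes modulo {1, -1}, as sets of loops. *)
Definition weyl_class (v : loop) : set loop :=
  [set x | x = v \/ x = (fun z => - v z)].

Definition affine_weyl : set (set loop) :=
  [set w | exists (n : int) (eps : 'Z_4), w = weyl_class (weyl_loop n eps)].

Definition weyl_one : set loop := weyl_class (fun=> 1%:M).
Definition weyl_r1 : set loop := weyl_class (fun=> rot).

Fact diag_loop0 z : diag_loop 0 z = 1%:M.
Proof.
rewrite /diag_loop oppr0 !expr0z; apply/matrixP => i j; rewrite !mxE.
by case: i => [[|[|[]]] ?] //; case: j => [[|[|[]]] ?].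
Qed.

Fact weyl_one_affine : affine_weyl weyl_one.
Proof.
exists 0, 0; congr weyl_class; apply/funext => z.
by rewrite /weyl_loop diag_loop0 mul1mx expr0.
Qed.

Fact weyl_r1_affine : affine_weyl weyl_r1.
Proof.
exists 0, 1; congr weyl_class; apply/funext => z.
by rewrite /weyl_loop diag_loop0 mul1mx expr1.
Qed.

Definition represented_in_SU11 (w : set loop) : Prop :=
  exists (n : int) (eps : 'Z_4),
    weyl_class (weyl_loop n eps) = w /\ forall z, SU11 (weyl_loop n eps z).

(* Holomorphic maps from the open unit disk to SL(2,C) with smooth boundary
   values: [f] extends continuously to the closed disk, with smooth restriction
   to the circle.  Values of [f] outside the closed disk are irrelevant. *)
Definition disk_map (f : R[i] -> 'M[R[i]]_2) : Prop :=
  [/\ forall z : R[i], `|z| < 1 -> \det (f z) = 1,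
      forall (z : R[i]), `|z| < 1 -> forall i j : 'I_2,
        derivable ((fun x => f x i j) : R[i]^o -> R[i]^o) z 1,
      {within [set z : R[i]^o | `|z| <= 1],
        continuous (f : R[i]^o -> 'M[R[i]^o]_2)}
    & smooth_loop (fun z => f (val z)) ].

(* Maps on the open unit disk at infinity, with [None] the point at infinity,
   read in the coordinate x = 1/z. *)
Definition disk_map_infty (f : option R[i] -> 'M[R[i]]_2) : Prop :=
  disk_map (fun x => f (if x == 0 then None else Some x^-1)).

Definition birkhoff (w : set loop) : set loop :=
  [set g | LSL2C g /\
    exists (n : int) (eps : 'Z_4) (l : option R[i] -> 'M[R[i]]_2)
           (m0 : R[i]) (a0 : R) (u : R[i] -> 'M[R[i]]_2),
    [/\ weyl_class (weyl_loop n eps) = w,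
        disk_map_infty l /\ (exists c, l None = mx2 1 0 c 1),
        `|m0| = 1 /\ 0 < a0,
        disk_map u /\ (exists b, u 0 = mx2 1 b 0 1)
      & forall z : circle,
          g z = l (Some (val z)) *m weyl_loop n eps z *m mx2 m0 0 0 m0^-1
                *m mx2 (a0%:C) 0 0 (a0^-1)%:C *m u (val z)] ].

Definition birkhoff_SU11 (n : int) (w : set loop) : set loop :=
  birkhoff w `&` LSU11_component n.

End LoopGroups.

Arguments weyl_one R : clear implicits.
Arguments weyl_r1 R : clear implicits.
Arguments LSL2C R : clear implicits.
Arguments LSU11 R : clear implicits.
Arguments affine_weyl R : clear implicits.
Arguments LSU11_component R n : clear implicits.

(* Main.v *)
Require Import Defs.
From HB Require Import structures.
From mathcomp Require Import all_boot all_order all_algebra.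
From mathcomp Require Import ring lra.
Import Order.TTheory GRing.Theory Num.Theory.
Import numFieldNormedType.Exports.
Local Open Scope classical_set_scope.
Local Open Scope ring_scope.
Set Implicit Arguments.
Unset Strict Implicit.
Unset Printing Implicit Defensive.

(** Part (a).  The loop g = [[c z, -1], [-1, c / z]] with c = sqrt 2 takes its
    values in SU(1,1), and moving the off-diagonal entry from 0 to -1 joins
    diag(z, 1/z) to it, so g lies in the component of degree 1.  Eliminating the
    diagonal entries gives g = l r_1 u, where l = [[1, 0], [- c / z, 1]] and
    u = [[1, 0], [- c z, 1]]; hence r_1 occurs (degree_one_birkhoff).  A loop that
    represents r_1 is one of the constants r_1 and - r_1, whose off-diagonal
    entries are not conjugate to each other.

    Part (b).  A loop g = l D u with D constant has an injective Toeplitz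
    operator: if v is a vector holomorphic in the disk such that g v extends
    holomorphically outside the disk and vanishes at infinity, then D u v and
    l^-1 g v agree on the circle, so v = 0.  It therefore suffices to find in the
    component of degree 0 a loop with a kernel vector.  With c = sqrt 2, the loop
    with rows (c (c - z) / (c - 1/z), 1) and (1, c (c - 1/z) / (c - z)) maps
    v = (- 1 / (c - z), 1) to - x (1 / (c - x), 1), where x = 1/z
    (degree_zero_kernel), and it belongs to a path of SU(1,1)-loops that starts at
    the identity (degree_zero_component).

    That the two extensions must vanish is proved as follows.  Let w be
    holomorphic in z and h holomorphic in x, with h vanishing at x = 0 and w = h
    on the circle.  As x is the conjugate of z there, the function P, the sum of
    the products w_i(z) conj(h_i(conj z)), is holomorphic in the disk, vanishes at
    0, and equals |w|^2 on the circle.  If w has no zero on the circle this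
    contradicts the mean value property in the form of disk_algebra_Re_gt0: a
    positive real part on the circle forces a positive real part at the centre.

    The factors are only known to be complex differentiable at each point, so
    the mean value property rests on Goursat's bisection
    (additive_rectangle_eq0), applied in logarithmic polar coordinates, where a
    circle is a vertical segment and the two horizontal sides of the rectangle
    [a, b] x [0, 2 pi] cancel.  Line integrals enter only as increments of
    primitives.

    Connectedness of the paths for the topology of uniform convergence of all
    derivatives is obtained from a class of families of functions that is closed
    under sums, products and inverses of functions bounded away from 0
    (smooth_family). *)

(** * Goursat's theorem for rectangles *)

Section Goursat.
Variable R : realType.
Implicit Types (a b c d x y t : R) (f F : R -> R).

Definition primitive a f x : R := \int[lebesgue_measure]_(t in `[a, x]) f t.

Lemma is_derive_primitive a f x : continuous f -> a < x ->
  is_derive x 1 (primitive a f) (f x).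
Proof.
move=> cf ax.
have fi : lebesgue_measure.-integrable `[a, x + 1] (EFin \o f).
  apply: continuous_compact_integrable; first exact: segment_compact.
  exact: continuous_subspaceT.
have x1 : x < x + 1 by rewrite ltrDl.
have [df dfE] := continuous_FTC1_closed x1 fi ax (cf x).
by apply: DeriveDef; [exact: df|rewrite derive1E in dfE].
Qed.

Lemma mean_value F f a b : a <= b ->
  (forall x, a <= x <= b -> is_derive x 1 F (f x)) ->
  exists2 x, a <= x <= b & F b - F a = f x * (b - a).
Proof.
move=> ab dF; have [||x xab ->] := @MVT_segment R F f a b ab.
- by move=> x; rewrite in_itv/= => /andP[/ltW ax /ltW xb]; apply: dF; rewrite ax.
- apply: derivable_within_continuous => x; rewrite in_itv/= => xab.
  by have [] := dF x xab.
by exists x => //; move: xab; rewrite in_itv.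
Qed.

Lemma near_constant_increment F f k e a b : a <= b ->
  (forall x, a <= x <= b -> is_derive x 1 F (f x)) ->
  (forall x, a <= x <= b -> `|f x - k| <= e) ->
  `|F b - F a - k * (b - a)| <= e * (b - a).
Proof.
move=> ab dF fk; have [x xab ->] := mean_value ab dF.
rewrite -mulrBl normrM (ger0_norm (_ : 0 <= b - a)) ?subr_ge0//.
by rewrite ler_wpM2r ?subr_ge0//; apply: fk.
Qed.

(** One step of the bisection: mu is the sum of its values on the four quarters,
    and the square of the half perimeter is four times that of a quarter. *)
Lemma bad_quarter (mu : R -> R -> R -> R -> R) k x y w h :
  (forall a m b c d, mu a b c d = mu a m c d + mu m b c d) ->
  (forall a b c m d, mu a b c d = mu a b c m + mu a b m d) ->
  k * (w + w + (h + h)) ^+ 2 < `|mu x (x + (w + w)) y (y + (h + h))| ->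
  exists2 p : R * R, (p.1 = x \/ p.1 = x + w) /\ (p.2 = y \/ p.2 = y + h) &
    k * (w + h) ^+ 2 < `|mu p.1 (p.1 + w) p.2 (p.2 + h)|.
Proof.
move=> mux muy; rewrite (mux x (x + w)) (muy x _ y (y + h)).
rewrite (muy (x + w) _ y (y + h)) !addrA => B.
pose q := k * (w + h) ^+ 2.
have [b1|b1] := ltP q `|mu x (x + w) y (y + h)|.
  by exists (x, y) => //=; split; left.
have [b2|b2] := ltP q `|mu (x + w) (x + w + w) y (y + h)|.
  by exists (x + w, y) => //=; split; [right|left].
have [b3|b3] := ltP q `|mu x (x + w) (y + h) (y + h + h)|.
  by exists (x, y + h) => //=; split; [left|right].
have [b4|b4] := ltP q `|mu (x + w) (x + w + w) (y + h) (y + h + h)|.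
  by exists (x + w, y + h) => //=; split; right.
exfalso; move: B b1 b2 b3 b4.
move: (mu _ _ _ _) (mu _ _ _ _) (mu _ _ _ _) (mu _ _ _ _) => m1 m2 m3 m4.
have -> : k * (w + w + h + h) ^+ 2 = q + q + q + q by rewrite /q; ring.
rewrite ltNge => /negP B b1 b2 b3 b4; apply: B.
by do 3 (apply: le_trans (ler_normD _ _) _; apply: lerD => //).
Qed.

(** If mu did not vanish, a nested sequence of quarters would keep mu above
    k (half perimeter)^2; at the common point of these rectangles the local
    estimate with e = k says the opposite. *)
Lemma additive_rectangle_eq0 (mu : R -> R -> R -> R -> R) a b c d :
  a <= b -> c <= d ->
  (forall a m b c d, mu a b c d = mu a m c d + mu m b c d) ->
  (forall a b c m d, mu a b c d = mu a b c m + mu a b m d) ->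
  (forall x y, a <= x <= b -> c <= y <= d ->
    forall e, 0 < e -> exists2 r, 0 < r & forall a' b' c' d',
      a <= a' -> b' <= b -> c <= c' -> d' <= d ->
      a' <= x <= b' -> c' <= y <= d' -> b' - a' < r -> d' - c' < r ->
      `|mu a' b' c' d'| <= e * (b' - a' + (d' - c')) ^+ 2) ->
  mu a b c d = 0.
Proof.
move=> ab cd mux muy loc; apply/eqP/negP => /negP mu0.
pose s := b - a + (d - c).
(* The + 1 keeps the denominator positive on a degenerate rectangle. *)
pose k := `|mu a b c d| / (s ^+ 2 + 1).
have s0 : 0 < s ^+ 2 + 1 by rewrite ltr_wpDl// sqr_ge0.
have k0 : 0 < k by rewrite divr_gt0// normr_gt0.
have ks : k * s ^+ 2 < `|mu a b c d|.
  by rewrite /k mulrAC ltr_pdivrMr// ltr_pM2l ?normr_gt0// ltrDl.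
pose w n := (b - a) / 2 ^+ n; pose h n := (d - c) / 2 ^+ n.
have half t n : t / 2 ^+ n = t / 2 ^+ n.+1 + t / 2 ^+ n.+1.
  by rewrite exprS; field; rewrite expf_neq0.
have w0 n : 0 <= w n by rewrite divr_ge0 ?subr_ge0// exprn_ge0.
have h0 n : 0 <= h n by rewrite divr_ge0 ?subr_ge0// exprn_ge0.
pose bad n (p : R * R) :=
  k * (w n + h n) ^+ 2 < `|mu p.1 (p.1 + w n) p.2 (p.2 + h n)|.
pose nested n (p q : R * R) :=
  (p.1 <= q.1 /\ q.1 + w n.+1 <= p.1 + w n) /\
  (p.2 <= q.2 /\ q.2 + h n.+1 <= p.2 + h n).
have /choice[next nextP] : forall np : nat * (R * R), exists q,
    bad np.1 np.2 -> bad np.1.+1 q /\ nested np.1 np.2 q.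
  move=> [n [x y]] /=.
  have [bn|nb] := boolP (bad n (x, y)); last by exists 0.
  have := bn; rewrite /bad/= /w /h (half (b - a) n) (half (d - c) n).
  move=> /(bad_quarter mux muy)[q qE bq]; exists q => _; split => //.
  rewrite /nested/=.
  have := half (b - a) n; have := half (d - c) n; rewrite -/(w n) -/(h n).
  rewrite -/(w n.+1) -/(h n.+1) => hn wn.
  have := w0 n.+1; have := h0 n.+1; move: qE; rewrite -/(w n.+1) -/(h n.+1).
  rewrite hn wn; move: (w n.+1) (h n.+1) => w' h'.
  by case=> -[->|->] [->|->] hn0 wn0; clear -hn0 wn0; split; split; lra.
pose fix p (n : nat) : R * R := if n is n'.+1 then next (n', p n') else (a, c).
have badp n : bad n (p n).
  elim: n => [|n IH]; last by have [] := nextP (n, p n) IH.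
  by rewrite /bad/= /w /h !expr0 !divr1 !subrKC.
have nestp n : nested n (p n) (p n.+1) by have [] := nextP (n, p n) (badp n).
have inside n : (a <= (p n).1 /\ (p n).1 + w n <= b) /\
    (c <= (p n).2 /\ (p n).2 + h n <= d).
  elim: n => [|n [[? ?] [? ?]]]; first by rewrite /= /w /h !expr0 !divr1 !subrKC.
  have [[? ?] [? ?]] := nestp n.
  by split; split; lra.
(* Lower left and upper right corners are monotone, which gives a point common
   to all the rectangles. *)
have limit (u v : nat -> R) : (forall n, u n <= u n.+1) ->
    (forall n, v n.+1 <= v n) -> (forall n, u n <= v n) ->
    exists x, forall n, u n <= x <= v n.
  move=> /nondecreasing_seqP uu /nonincreasing_seqP vv uv.
  have uvnm n m : u n <= v m.
    apply: le_trans (uu _ _ (leq_maxl n m)) _; apply: le_trans (uv _) _.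
    exact: vv (leq_maxr n m).
  exists (sup (range u)) => n; apply/andP; split.
    apply: ub_le_sup; last by exists n.
    by exists (v 0) => _ [m _ <-].
  by apply: ge_sup; [exists (u 0), 0|move=> _ [m _ <-]].
have [x xP] : exists x, forall n, (p n).1 <= x <= (p n).1 + w n.
  apply: limit => n; [by have [[]] := nestp n|by have [[]] := nestp n|].
  by rewrite lerDl.
have [y yP] : exists y, forall n, (p n).2 <= y <= (p n).2 + h n.
  apply: limit => n; [by have [_ []] := nestp n|by have [_ []] := nestp n|].
  by rewrite lerDl.
have := xP 0; have := yP 0; rewrite /= /w /h !expr0 !divr1 !subrKC => yab xab.
have [r r0 rP] := loc x y xab yab k k0.
have small t : 0 <= t -> exists n, forall m, (n <= m)%N -> t / 2 ^+ m < r.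
  move=> t0; exists (Num.bound (t / r)) => m nm.
  rewrite ltr_pdivrMr ?exprn_gt0// mulrC -ltr_pdivrMr//.
  apply: lt_le_trans (archi_boundP _) _; first by rewrite divr_ge0// ltW.
  by rewrite -natrX ler_nat ltnW// (leq_ltn_trans nm)// ltn_expl.
have [|n1 wr] := small (b - a); first by rewrite subr_ge0.
have [|n2 hr] := small (d - c); first by rewrite subr_ge0.
pose n := maxn n1 n2.
have := badp n; rewrite /bad ltNge => /negP; apply.
have [[? ?] [? ?]] := inside n.
have := rP _ _ _ _ _ _ _ _ (xP n) (yP n).
rewrite !(addrAC _ _ (- _)) !subrr !add0r; apply => //.
- by apply: wr; rewrite leq_maxl.
- by apply: hr; rewrite leq_maxr.
Qed.

(** Green's theorem for the form V dx + U dy, whose coefficients are only assumed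
    to be differentiable at each point, with the same A as the partial derivative
    of U in x and of V in y.  The integrals along the four sides are increments of
    the primitives FU x and FV y, so that additivity in the rectangle is an
    identity between differences. *)
Lemma curl_free_circulation_eq0 (U V FU FV : R -> R -> R) a b c d :
  a <= b -> c <= d ->
  (forall x y, a <= x <= b -> c <= y <= d -> is_derive y 1 (FU x) (U x y)) ->
  (forall x y, a <= x <= b -> c <= y <= d -> is_derive x 1 (FV y) (V x y)) ->
  (forall x y, a <= x <= b -> c <= y <= d -> exists A B C,
    forall e, 0 < e -> exists2 r, 0 < r & forall x' y',
      a <= x' <= b -> c <= y' <= d -> `|x' - x| < r -> `|y' - y| < r ->
      `|U x' y' - U x y - (A * (x' - x) + B * (y' - y))|
        <= e * (`|x' - x| + `|y' - y|) /\
      `|V x' y' - V x y - (C * (x' - x) + A * (y' - y))|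
        <= e * (`|x' - x| + `|y' - y|)) ->
  FU b d - FU b c - (FU a d - FU a c) = FV d b - FV d a - (FV c b - FV c a).
Proof.
move=> ab cd dU dV loc; apply/eqP; rewrite -subr_eq0; apply/eqP.
apply: (additive_rectangle_eq0 (mu := fun a b c d =>
  FU b d - FU b c - (FU a d - FU a c) - (FV d b - FV d a - (FV c b - FV c a)))
  ab cd) => [*|*|x y xab yab e e0]; [by ring|by ring|].
have [A [B [C /(_ (e / 2))]]] := loc x y xab yab.
case=> [|r r0 rP]; first by rewrite divr_gt0.
exists r => // a' b' c' d' aa' bb' cc' dd' /andP[ax xb] /andP[cy yd] wr hr.
have wh x' y' : a' <= x' <= b' -> c' <= y' <= d' ->
  [/\ `|x' - x| <= b' - a', `|y' - y| <= d' - c', a <= x' <= b & c <= y' <= d].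
  clear -aa' bb' cc' dd' ax xb cy yd => /andP[? ?] /andP[? ?].
  by rewrite !ler_norml; split; apply/andP; split; lra.
have est x' y' : a' <= x' <= b' -> c' <= y' <= d' ->
  `|U x' y' - U x y - (A * (x' - x) + B * (y' - y))|
     <= e / 2 * (b' - a' + (d' - c')) /\
  `|V x' y' - V x y - (C * (x' - x) + A * (y' - y))|
     <= e / 2 * (b' - a' + (d' - c')).
  move=> xab' ycd'; have [xw yh xx yy] := wh x' y' xab' ycd'.
  have [u v] := rP x' y' xx yy (le_lt_trans xw wr) (le_lt_trans yh hr).
  by split; apply: le_trans (_ : _ <= e / 2 * (`|x' - x| + `|y' - y|)) _ => //;
    rewrite ler_pM2l ?divr_gt0// lerD.
have aa : a' <= a' <= b' by rewrite lexx (le_trans ax).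
have bb : a' <= b' <= b' by rewrite lexx (le_trans ax).
have cc : c' <= c' <= d' by rewrite lexx (le_trans cy).
have dd : c' <= d' <= d' by rewrite lexx (le_trans cy).
have cd' : c' <= d' by exact: le_trans yd.
have ab' : a' <= b' by exact: le_trans xb.
have incU := @near_constant_increment (FU b' - FU a')
  (fun y' => U b' y' - U a' y') (A * (b' - a')) (e * (b' - a' + (d' - c')))
  c' d' cd' _ _.
have incV := @near_constant_increment (FV d' - FV c')
  (fun x' => V x' d' - V x' c') (A * (d' - c')) (e * (b' - a' + (d' - c')))
  a' b' ab' _ _.
have {}incU : `|FU b' d' - FU b' c' - (FU a' d' - FU a' c')
    - A * (b' - a') * (d' - c')| <= e * (b' - a' + (d' - c')) * (d' - c').
  rewrite [X in `|X - _|](_ : _ = (FU b' - FU a') d' - (FU b' - FU a') c').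
    apply: incU => [y' ycd'|y' ycd'].
      have [_ _ xx yy] := wh b' y' bb ycd'; have [_ _ xx' _] := wh a' y' aa ycd'.
      by apply: is_deriveB; apply: dU.
    have [eb _] := est b' y' bb ycd'; have [ea _] := est a' y' aa ycd'.
    move: ea eb; clear; rewrite !ler_norml => /andP[? ?] /andP[? ?].
    by apply/andP; split; lra.
  by rewrite !fctE; ring.
have {}incV : `|FV d' b' - FV d' a' - (FV c' b' - FV c' a')
    - A * (d' - c') * (b' - a')| <= e * (b' - a' + (d' - c')) * (b' - a').
  rewrite [X in `|X - _|](_ : _ = (FV d' - FV c') b' - (FV d' - FV c') a').
    apply: incV => [x' xab'|x' xab'].
      have [_ _ xx yy] := wh x' d' xab' dd; have [_ _ _ yy'] := wh x' c' xab' cc.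
      by apply: is_deriveB; apply: dV.
    have [_ eb] := est x' d' xab' dd; have [_ ea] := est x' c' xab' cc.
    move: ea eb; clear; rewrite !ler_norml => /andP[? ?] /andP[? ?].
    by apply/andP; split; lra.
  by rewrite !fctE; ring.
move: incU incV; set u := FU b' d' - _ - _; set v := FV d' b' - _ - _.
have -> : A * (d' - c') * (b' - a') = A * (b' - a') * (d' - c') by ring.
have -> : e * (b' - a' + (d' - c')) ^+ 2 =
  e * (b' - a' + (d' - c')) * (d' - c') + e * (b' - a' + (d' - c')) * (b' - a').
  by ring.
move: u v (A * _ * _) (e * _ * _) (e * _ * _) => u v p q s.
clear; rewrite !ler_norml => /andP[? ?] /andP[? ?].
by apply/andP; split; lra.
Qed.

End Goursat.
(** * The disk algebra and its mean value property *)

Lemma is_derive_littleoP (K : numFieldType) (f : K^o -> K^o) (x d : K) :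
  is_derive x 1 f d <-> forall e : K, 0 < e -> exists2 r : K, 0 < r &
    forall y, `|y - x| < r -> `|f y - f x - d * (y - x)| <= e * `|y - x|.
Proof.
split=> [[df fd] e e0|H].
  have fx : h^-1 *: (f (h *: 1 + x) - f x) @[h --> 0^'] --> (d : K^o).
    by rewrite -fd; exact: df.
  move/cvgrPdist_le : fx => /(_ e e0)/nbhs_normP[r /= r0 rP].
  exists r => // y yr; have [->|yx] := eqVneq y x.
    by rewrite !subrr mulr0 subrr normr0 mulr0.
  have yx0 : y - x != 0 by rewrite subr_eq0.
  have := rP (y - x); rewrite /= sub0r normrN => /(_ yr yx0).
  rewrite -ler_pdivrMr ?normr_gt0// -normfV -normrM mulrBl.
  rewrite -mulrA divff// mulr1 /GRing.scale/= mulr1 subrK distrC.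
  by rewrite [_ * (f y - _)]mulrC.
have fx : h^-1 *: (f (h *: 1 + x) - f x) @[h --> 0^'] --> (d : K^o).
  apply/cvgrPdist_le => e /H[r r0 rP].
  apply/nbhs_normP; exists r => //= h /=; rewrite sub0r normrN => hr h0.
  have := rP (h + x); rewrite addrK => /(_ hr).
  rewrite distrC -ler_pdivrMr ?normr_gt0// -normfV -normrM mulrBl.
  rewrite -mulrA divff// mulr1; congr (_ <= _).
  by congr (`|d - _|); rewrite /GRing.scale/= mulr1 mulrC.
by apply: DeriveDef; [apply/cvg_ex; exists d|exact: cvg_lim fx].
Qed.

Section ComplexTopology.
Variable R : realType.
Local Notation C := R[i].
Local Open Scope complex_scope.
Implicit Types (z w : C) (e r : R).

Lemma normc_le_ReIm z : `|z| <= (`|complex.Re z| + `|complex.Im z|)%:C.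
Proof.
case: z => x y; rewrite normc_def/= lecR -(ler_pXn2r (n := 2)) ?nnegrE//.
rewrite sqr_sqrtr ?addr_ge0 ?sqr_ge0// sqrrD !real_normK ?num_real//.
by rewrite lerD2r lerDl mulrn_wge0// mulr_ge0.
Qed.

Lemma Im_le_normc z : `|complex.Im z|%:C <= `|z|.
Proof.
case: z => x y; rewrite normc_def/= lecR -sqrtr_sqr.
by rewrite ler_wsqrtr// lerDr sqr_ge0.
Qed.

Lemma gt0_complexP z : 0 < z -> exists r : R, z = r%:C.
Proof. by move=> z0; exists (complex.Re z); rewrite RRe_real// realE ltW. Qed.

(** Boxes with real sides generate the topology of the complex numbers, which
    reduces convergence to that of real and imaginary parts; the norm itself has
    complex values. *)
Lemma nbhs_complexP z (A : set C) :
  nbhs (z : C^o) A <-> exists2 r : R, 0 < r & forall w,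
    `|complex.Re (w - z)| < r -> `|complex.Im (w - z)| < r -> A w.
Proof.
split=> [/nbhs_normP[e /= e0 eA]|[r r0 rA]].
  have [r eE] := gt0_complexP e0.
  move: e0 eA; rewrite eE ltcR => r0 eA.
  exists (r / 2) => [|w xw yw]; first by rewrite divr_gt0.
  apply: eA; rewrite /= distrC (le_lt_trans (normc_le_ReIm _))// ltcR.
  by rewrite [r]splitr ltrD.
apply/(@nbhs_normP _ C^o); exists r%:C => /=; first by rewrite ltcR.
move=> w /=; rewrite distrC => wr; apply: rA; rewrite -ltcR.
  exact: le_lt_trans (normc_ge_Re _) wr.
exact: le_lt_trans (Im_le_normc _) wr.
Qed.

Lemma cvg_complexP (T : Type) (F : set_system T) {FF : Filter F}
    (f : T -> C) z :
  f @ F --> (z : C^o) <->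
  ((fun t => complex.Re (f t)) @ F --> complex.Re z /\
   (fun t => complex.Im (f t)) @ F --> complex.Im z).
Proof.
split=> [fz|[fx fy]].
  split; apply/cvgrPdist_lt => e e0.
    apply: (fz [set w | `|complex.Re z - complex.Re w| < e]).
    apply/nbhs_complexP; exists e => // w xw _ /=.
    by rewrite distrC -raddfB.
  apply: (fz [set w | `|complex.Im z - complex.Im w| < e]).
  apply/nbhs_complexP; exists e => // w _ yw /=.
  by rewrite distrC -raddfB.
move=> A /nbhs_complexP[r r0 rA].
move/cvgrPdist_lt : fx => /(_ _ r0) fx; move/cvgrPdist_lt : fy => /(_ _ r0) fy.
apply: filterS2 fx fy => t; rewrite distrC => xt; rewrite distrC => yt.
by apply: rA; rewrite raddfB.
Qed.

Lemma Re_continuous : continuous (@complex.Re R : C^o -> R).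
Proof.
move=> z; have [] := iffLR (cvg_complexP (F := nbhs (z : C^o)) id z) => //.
Qed.

Lemma Im_continuous : continuous (@complex.Im R : C^o -> R).
Proof.
move=> z; have [] := iffLR (cvg_complexP (F := nbhs (z : C^o)) id z) => //.
Qed.

Lemma Re_conj z : complex.Re z^* = complex.Re z. Proof. by case: z. Qed.
Lemma Im_conj z : complex.Im z^* = - complex.Im z. Proof. by case: z. Qed.

Lemma conjcB z w : conjc (z - w) = conjc z - conjc w.
Proof. exact: (rmorphB (@conjc R)). Qed.
Lemma conjcM z w : conjc (z * w) = conjc z * conjc w.
Proof. exact: (rmorphM (@conjc R)). Qed.

Lemma conj_continuous : continuous (@conjc R : C^o -> C^o).
Proof.
move=> z; apply: (iffRL (cvg_complexP (F := nbhs (z : C^o)) _ _)); split.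
  under eq_fun do rewrite Re_conj; rewrite Re_conj; exact: Re_continuous.
under eq_fun do rewrite Im_conj; rewrite Im_conj; apply: cvgN.
exact: Im_continuous.
Qed.

Definition closed_disk : set C^o := [set z | `|z| <= 1].

Definition disk_algebra (P : C -> C) : Prop :=
  (forall z, `|z| < 1 -> derivable (P : C^o -> C^o) z 1) /\
  {within closed_disk, continuous (P : C^o -> C^o)}.

Lemma disk_algebra_cst z : disk_algebra (fun=> z).
Proof. by split=> [w _|]; [exact: derivable_cst|move=> x; exact: cvg_cst]. Qed.

Lemma disk_algebra_id : disk_algebra id.
Proof.
split=> [w _|]; first exact: derivable_id.
by apply: continuous_subspaceT => z; exact: cvg_id.
Qed.

Lemma disk_algebraD P Q :
  disk_algebra P -> disk_algebra Q -> disk_algebra (fun z => P z + Q z).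
Proof.
move=> [dP cP] [dQ cQ]; split=> [z z1|z].
  by apply: derivableD; [exact: dP|exact: dQ].
by apply: (@cvgD _ C^o); [exact: cP|exact: cQ].
Qed.

Lemma disk_algebraM P Q :
  disk_algebra P -> disk_algebra Q -> disk_algebra (fun z => P z * Q z).
Proof.
move=> [dP cP] [dQ cQ]; split=> [z z1|z].
  by apply: (@derivableM _ C^o); [exact: dP|exact: dQ].
by apply: (@cvgM C); [exact: cP|exact: cQ].
Qed.

Lemma disk_algebraN P : disk_algebra P -> disk_algebra (fun z => - P z).
Proof.
move=> [dP cP]; split=> [z z1|z].
  by apply: derivableN; exact: dP.
by apply: (@cvgN _ C^o); exact: cP.
Qed.

Lemma disk_algebraV P : (forall z, `|z| <= 1 -> P z != 0) ->
  disk_algebra P -> disk_algebra (fun z => (P z)^-1).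
Proof.
move=> P0 [dP cP]; split=> [z z1|].
  by apply: (@derivableV _ C^o); [exact/P0/ltW|exact: dP].
apply/subspace_continuousP => z z1; apply: (@cvgV C); first exact: P0.
by move/subspace_continuousP: cP; exact.
Qed.

Lemma disk_algebra_cvg (T : Type) (F : set_system T) {FF : Filter F} P
    (g : T -> C) z :
  disk_algebra P -> `|z| <= 1 -> g @ F --> (z : C^o) ->
  (\forall t \near F, `|g t| <= 1) -> (fun t => P (g t)) @ F --> (P z : C^o).
Proof.
move=> [_ /subspace_continuousP cP] z1 gz g1.
move=> A /(cP z z1) PA; rewrite /nbhs/=.
have gA := gz (fun w => closed_disk w -> A (P w)) PA.
by apply: (@filterS2 _ F FF _ _ _ _ gA g1) => t + g1t; exact.
Qed.

Lemma derivable_complexP P z : derivable (P : C^o -> C^o) z 1 <->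
  exists D, forall e, 0 < e -> exists2 r : R, 0 < r & forall w,
    `|w - z| < r%:C -> `|P w - P z - D * (w - z)| <= e%:C * `|w - z|.
Proof.
split=> [/derivableP/is_derive_littleoP dP|[D PD]].
  exists ('D_1 (P : C^o -> C^o) z) => e e0; have [|r] := dP e%:C.
    by rewrite ltcR.
  move=> r0 rP; have [r' rE] := gt0_complexP r0.
  by move: r0 rP; rewrite rE ltcR => r0 rP; exists r'.
suff : is_derive (z : C^o) 1 (P : C^o -> C^o) D by case.
apply/is_derive_littleoP => e e0; have [e' eE] := gt0_complexP e0.
move: e0; rewrite eE ltcR => /PD[r r0 rP].
by exists r%:C => //; rewrite ltcR.
Qed.

(** The difference quotient at z is conjugate to that of P at the conjugate of z. *)
Lemma disk_algebra_conj P :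
  disk_algebra P -> disk_algebra (fun z => conjc (P (conjc z))).
Proof.
move=> [dP cP]; split=> [z z1|].
  have : derivable (P : C^o -> C^o) (conjc z) 1 by apply: dP; rewrite normcJ.
  move=> /derivable_complexP[D PD]; apply/derivable_complexP; exists (conjc D).
  move=> e e0; have [r r0 rP] := PD e e0; exists r => // w wr.
  have -> : conjc D * (w - z) = conjc (D * (conjc w - conjc z)).
    by rewrite conjcM -conjcB !conjcK.
  rewrite -!conjcB normcJ -[`|w - z|]normcJ conjcB; apply: rP.
  by rewrite -conjcB normcJ.
apply/subspace_continuousP => z z1.
have cz : conjc w @[w --> within closed_disk (nbhs z)] --> (conjc z : C^o).
  move=> A /(@conj_continuous z) zA.
  by apply: (@filterS _ (nbhs z) _ _ _ _ zA) => w + _; exact.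
have Pz : P (conjc w) @[w --> within closed_disk (nbhs z)]
    --> (P (conjc z) : C^o).
  apply: (disk_algebra_cvg (F := within closed_disk (nbhs z)) _ _ cz) => //.
    by rewrite normcJ.
  by apply: (@filterE _ (nbhs z)) => w; rewrite /closed_disk/= normcJ.
exact: (cvg_comp _ _ Pz (@conj_continuous _)).
Qed.


(** The exponential of x + i y; its restriction to the half-plane x < 0 covers the
    punctured disk. *)
Definition polar (x y : R) : C := (expR x * cos y) +i* (expR x * sin y).

Lemma normc_polar x y : `|polar x y| = (expR x)%:C.
Proof.
rewrite normc_def/= !exprMn -mulrDr cos2Dsin2 mulr1.
by rewrite sqrtr_sqr gtr0_norm ?expR_gt0.
Qed.

Lemma polarD x y h k : polar (x + h) (y + k) = polar x y * polar h k.
Proof.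
by rewrite /polar expRD cosD sinD; apply/eqP; rewrite eq_complex/=;
  apply/andP; split; apply/eqP; ring.
Qed.

Lemma polar_local e : 0 < e -> exists2 r : R, 0 < r & forall h k,
  `|h| < r -> `|k| < r ->
  `|polar h k - 1 - (h +i* k)| <= (e * (`|h| + `|k|))%:C.
Proof.
move=> e0; pose e' := Num.min 1 (e / 5).
have e'0 : 0 < e' by rewrite lt_min ltr01 divr_gt0.
have e'1 : e' <= 1 by rewrite ge_min lexx.
have e'5 : e' * 5 <= e by rewrite -ler_pdivlMr// ge_min lexx orbT.
have [r1 r10 r1P] :=
  iffLR (is_derive_littleoP _ _ _) (is_derive_expR (0 : R)) _ e'0.
have [r2 r20 r2P] :=
  iffLR (is_derive_littleoP _ _ _) (is_derive_sin (0 : R)) _ e'0.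
have [r3 r30 r3P] :=
  iffLR (is_derive_littleoP _ _ _) (is_derive_cos (0 : R)) _ e'0.
exists (Num.min (Num.min r1 r2) (Num.min r3 (e' / 2))).
  by rewrite !lt_min r10 r20 r30 divr_gt0.
move=> h k; rewrite !lt_min => /andP[/andP[h1 h2] /andP[h3 h4]].
move=> /andP[/andP[k1 k2] /andP[k3 k4]].
have := r1P h; have := r2P k; have := r3P k.
rewrite !subr0 expR0 sin0 cos0 !subr0 oppr0 !mul1r mul0r !subr0.
move=> /(_ k3) ck /(_ k2) sk /(_ h1) eh.
apply: le_trans (normc_le_ReIm _) _; rewrite lecR /polar /=.
have E0 := expR_gt0 h; move: (expR h) (cos k) (sin k) eh ck sk E0 => E c s eh ck sk E0.
have h0 := normr_ge0 h; have k0 := normr_ge0 k.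
have E1 : `|E - 1| <= 2 * `|h|.
  have -> : E - 1 = (E - 1 - h) + h by ring.
  apply: le_trans (ler_normD _ _) _; have : e' * `|h| <= `|h| by rewrite ler_piMl.
  lra.
have E2 : `|E| <= 2.
  have -> : E = (E - 1) + 1 by ring.
  apply: le_trans (ler_normD _ _) _; rewrite normr1; lra.
have b1 : `|E * (c - 1)| <= 2 * (e' * `|k|) by rewrite normrM ler_pM.
have b2 : `|E * (s - k)| <= 2 * (e' * `|k|) by rewrite normrM ler_pM.
have b3 : `|(E - 1) * k| <= e' * `|k|.
  by rewrite normrM ler_wpM2r//; lra.
have -> : E * c - 1 - h = E * (c - 1) + (E - 1 - h) by ring.
have -> : E * s + - 0 - k = E * (s - k) + (E - 1) * k by ring.
have := ler_normD (E * (c - 1)) (E - 1 - h).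
have := ler_normD (E * (s - k)) ((E - 1) * k).
have : e' * 5 * `|h| <= e * `|h| by rewrite ler_wpM2r.
have : e' * 5 * `|k| <= e * `|k| by rewrite ler_wpM2r.
have : 0 <= e' * `|h| by rewrite mulr_ge0// ltW.
rewrite mulrDr; clear -b1 b2 b3 eh; lra.
Qed.


Lemma realcM (x y : R) : (x * y)%:C = x%:C * y%:C.
Proof. exact: (rmorphM (@real_complex R)). Qed.
Lemma realcD (x y : R) : (x + y)%:C = x%:C + y%:C.
Proof. exact: (rmorphD (@real_complex R)). Qed.

Lemma realcV (x : R) : (x^-1)%:C = x%:C^-1.
Proof. exact: (fmorphV (@real_complex R)). Qed.

(** In logarithmic polar coordinates a holomorphic function satisfies the
    Cauchy-Riemann equations, A + i B being the derivative at the point multiplied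
    by the point. *)
Lemma derivable_polar_local P x y : x < 0 ->
  derivable (P : C^o -> C^o) (polar x y) 1 ->
  exists A B, forall e, 0 < e -> exists2 r : R, 0 < r & forall x' y',
    `|x' - x| < r -> `|y' - y| < r ->
    `|complex.Re (P (polar x' y')) - complex.Re (P (polar x y))
       - (A * (x' - x) - B * (y' - y))| <= e * (`|x' - x| + `|y' - y|) /\
    `|complex.Im (P (polar x' y')) - complex.Im (P (polar x y))
       - (B * (x' - x) + A * (y' - y))| <= e * (`|x' - x| + `|y' - y|).
Proof.
move=> x0 /derivable_complexP[D PD]; set z := polar x y.
have z1 : `|z| <= 1 by rewrite normc_polar lecR -expR0 ler_expR ltW.
exists (complex.Re (D * z)), (complex.Im (D * z)) => e e0.
pose d := complex.Re `|D|.
have dE : `|D| = d%:C by rewrite /d RRe_real// normr_real.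
have d0 : 0 <= d by rewrite -lecR -dE; exact: normr_ge0.
have [|r1 r10 r1P] := PD (e / 4); first by rewrite divr_gt0.
pose e' := Num.min 1 (e / 2 / (d + 1)).
have d1 : 0 < d + 1 by rewrite ltr_wpDl.
have e'0 : 0 < e' by rewrite lt_min ltr01 !divr_gt0.
have [r2 r20 r2P] := polar_local e'0.
exists (Num.min r2 (r1 / 4)) => [|x' y']; first by rewrite lt_min r20 divr_gt0.
rewrite !lt_min => /andP[x2 x1] /andP[y2 y1].
set h := x' - x in x1 x2 *; set k := y' - y in y1 y2 *; set s := `|h| + `|k|.
have s0 : 0 <= s by rewrite addr_ge0.
have zE : polar x' y' = z * polar h k by rewrite -polarD !subrKC.
have pol := r2P h k x2 y2.
have hk : `|h +i* k| <= s%:C by exact: normc_le_ReIm.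
have e's : e' * s <= s by rewrite ler_piMl// ge_min lexx.
have zz : `|polar x' y' - z| <= (2 * s)%:C.
  rewrite zE -{2}[z]mulr1 -mulrBr normrM.
  have -> : polar h k - 1 = (polar h k - 1 - (h +i* k)) + (h +i* k).
    by rewrite subrK.
  apply: le_trans (ler_piMl (normr_ge0 _) z1) _.
  apply: le_trans (ler_normD _ _) _; apply: le_trans (lerD pol hk) _.
  by rewrite -realcD lecR -/s; clear -e's; lra.
have main : `|P (polar x' y') - P z - D * z * (h +i* k)| <= (e * s)%:C.
  have -> : P (polar x' y') - P z - D * z * (h +i* k) =
      (P (polar x' y') - P z - D * (polar x' y' - z)) +
      D * (z * (polar h k - 1 - (h +i* k))) by rewrite zE; ring.
  apply: le_trans (ler_normD _ _) _.
  have b1 : `|P (polar x' y') - P z - D * (polar x' y' - z)| <=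
      (e / 4 * (2 * s))%:C.
    apply: le_trans (r1P _ _) _.
      apply: le_lt_trans zz _; rewrite ltcR /s; clear -x1 y1; lra.
    by rewrite [leRHS]realcM ler_wpM2l// lecR divr_ge0// ltW.
  have b2 : `|D * (z * (polar h k - 1 - (h +i* k)))| <= (e / 2 * s)%:C.
    rewrite normrM dE normrM.
    apply: le_trans (_ : _ <= d%:C * (e' * s)%:C) _.
      by rewrite ler_wpM2l ?lecR//; apply: le_trans (ler_piMl _ z1) pol.
    rewrite -realcM lecR mulrA ler_wpM2r//.
    apply: le_trans (_ : (d + 1) * e' <= _); first by rewrite ler_wpM2r ?lerDl// ltW.
    by rewrite mulrC -ler_pdivlMr// ge_min lexx orbT.
  by apply: le_trans (lerD b1 b2) _; rewrite -realcD lecR; clear; lra.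
split; rewrite -lecR.
  apply: le_trans main; apply: le_trans (normc_ge_Re _).
  by clear; case: (D * z) (P (polar x' y')) (P z) => [a b] [p q] [p' q'].
apply: le_trans main; apply: le_trans (Im_le_normc _).
clear; case: (D * z) (P (polar x' y')) (P z) => [a b] [p q] [p' q'] /=.
by rewrite [b * h + _]addrC.
Qed.

Lemma polar_continuousr x : continuous (polar x : R -> C^o).
Proof.
move=> y; apply: (iffRL (cvg_complexP (F := nbhs y) _ _)); split => /=.
  by apply: cvgM; [exact: cvg_cst|exact: continuous_cos].
by apply: cvgM; [exact: cvg_cst|exact: continuous_sin].
Qed.

Lemma polar_continuousl y : continuous ((fun x => polar x y) : R -> C^o).
Proof.
move=> x; apply: (iffRL (cvg_complexP (F := nbhs x) _ _)); split => /=.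
  by apply: cvgM; [exact: continuous_expR|exact: cvg_cst].
by apply: cvgM; [exact: continuous_expR|exact: cvg_cst].
Qed.


Local Notation pi := (@trigo.pi R).

(** Compactness of the circle; the same small number serves as lower bound and as
    logarithmic distance to the circle. *)
Lemma Re_gt0_near_circle P : disk_algebra P ->
  (forall z, `|z| = 1 -> 0 < complex.Re (P z)) ->
  exists2 e, 0 < e & forall y, 0 <= y <= 2 * pi ->
    e < complex.Re (P (polar (- e) y)).
Proof.
move=> dP P0.
have : \forall e \near 0^'+, `[0, 2 * pi] `<=`
    [set y | e < complex.Re (P (polar (- e) y))].
  have /compact_near_coveringP : compact `[0, 2 * pi : R].
    exact: segment_compact.
  apply=> y _.
  have polar1 : `|polar (- 0) y| = 1 by rewrite normc_polar oppr0 expR0.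
  pose F := filter_prod (nbhs y) (0 : R)^'+.
  have yF : t.1 @[t --> F] --> y by exact: cvg_fst.
  have eF : t.2 @[t --> F] --> (0 : R).
    exact: cvg_trans cvg_snd (cvg_within _).
  have gF : polar (- t.2) t.1 @[t --> F] --> (polar (- 0) y : C^o).
    apply/cvg_complexP; split => /=.
      apply: cvgM.
        by apply: (cvg_comp _ _ (cvgN eF)); exact: continuous_expR.
      by apply: (cvg_comp _ _ yF); exact: continuous_cos.
    apply: cvgM.
      by apply: (cvg_comp _ _ (cvgN eF)); exact: continuous_expR.
    by apply: (cvg_comp _ _ yF); exact: continuous_sin.
  have PF : P (polar (- t.2) t.1) @[t --> F] --> (P (polar (- 0) y) : C^o).
    apply: disk_algebra_cvg gF _ => //; first by rewrite polar1.
    have : \forall t \near F, 0 < t.2.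
      exact: (@cvg_snd _ _ (nbhs y) _ _ [set e | 0 < e] (nbhs_right_gt 0)).
    apply: (@filterS _ F) => t t0.
    by rewrite normc_polar lecR -expR0 ler_expR oppr_le0 ltW.
  have RF : complex.Re (P (polar (- t.2) t.1)) - t.2 @[t --> F] -->
      complex.Re (P (polar (- 0) y)) - 0.
    apply: cvgB => //; exact: (cvg_comp _ _ PF (@Re_continuous _)).
  have : \forall t \near F, 0 < complex.Re (P (polar (- t.2) t.1)) - t.2.
    by apply: (cvgr_gt _ RF); rewrite subr0 P0.
  by apply: (@filterS _ F) => t; rewrite subr_gt0.
move=> H; have [e [He e0]] : exists e, `[0, 2 * pi] `<=`
    [set y | e < complex.Re (P (polar (- e) y))] /\ 0 < e.
  by near (0 : R)^'+ => e; exists e; split=> //; near: e; exact: H.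
by exists e => // y y0; apply: He; rewrite /= in_itv.
Unshelve. all: by end_near. Qed.

(** The mean of Re P over the circle of radius exp a does not depend on a < 0.
    It is at least e near the unit circle, and less than e / 2 near the centre if
    Re (P 0) <= 0. *)
Lemma disk_algebra_Re_gt0 P : disk_algebra P ->
  (forall z, `|z| = 1 -> 0 < complex.Re (P z)) -> 0 < complex.Re (P 0).
Proof.
move=> dP P1; rewrite ltNge; apply/negP => P0.
have [e e0 eP] := Re_gt0_near_circle dP P1.
have e2 : 0 < e / 2 by rewrite divr_gt0.
have [r r0 rP] : exists2 r : R, 0 < r &
    forall z, `|z| < r%:C -> complex.Re (P z) < e / 2.
  have P0' : P z @[z --> (0 : C^o)] --> (P 0 : C^o).
    apply: (disk_algebra_cvg (F := nbhs (0 : C^o)) (g := id) dP) => //.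
      by rewrite normr0 ler01.
    apply/(@nbhs_normP _ C^o); exists 1 => /=; first exact: ltr01.
    by move=> z /=; rewrite sub0r normrN; exact: ltW.
  have RP0 := cvg_comp _ _ P0' (@Re_continuous _).
  have : \forall z \near (0 : C^o), complex.Re (P z) < e / 2.
    by apply: (cvgr_lt _ RP0); apply: le_lt_trans e2.
  move=> /nbhs_normP[r' /= r'0 rP']; have [r rE] := gt0_complexP r'0.
  exists r; first by rewrite -ltcR -rE.
  by move=> z zr; apply: rP'; rewrite /= sub0r normrN rE.
pose a := Num.min (- e - 1) (ln (r / 2)).
have ae : a < - e by rewrite gt_min ltrBlDr ltrDl ltr01.
have ar : expR a < r.
  apply: le_lt_trans (_ : r / 2 < r); last first.
    by rewrite ltr_pdivrMr// ltr_pMr// ltr1n.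
  rewrite -[leRHS]lnK ?ler_expR ?ge_min ?lexx ?orbT//.
  by rewrite posrE divr_gt0.
pose U x y := complex.Re (P (polar x y)).
pose V x y := complex.Im (P (polar x y)).
pose FU x := primitive (- 1) (U x).
(* P is controlled only in the closed disk, whence the truncation at - e; the
   primitives start left of the rectangle so as to be differentiable on it. *)
pose FV y := primitive (a - 1) (fun x => V (Num.min x (- e)) y).
have Ne0 : - e < 0 by rewrite oppr_lt0.
have pi0 := trigo.pi_gt0 R.
have dU (x y : R) : x <= - e -> 0 <= y -> is_derive y 1 (FU x) (U x y).
  move=> xe y0; apply: is_derive_primitive; last by rewrite (lt_le_trans _ y0) ?ltrN10.
  move=> y1; have polar1 y2 : `|polar x y2| <= 1.
    by rewrite normc_polar lecR -expR0 ler_expR (le_trans xe)// ltW.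
  have Py1 : P (polar x t) @[t --> y1] --> (P (polar x y1) : C^o).
    by apply: (disk_algebra_cvg dP _ (@polar_continuousr x y1)) => //; exact: filterE.
  exact: (cvg_comp _ _ Py1 (@Re_continuous _)).
have dV (x y : R) : a <= x <= - e -> is_derive x 1 (FV y) (V x y).
  move=> /andP[ax xe]; rewrite -[V x y]/((fun x => V x y) x) -{2}(min_idPl xe).
  apply: (@is_derive_primitive _ _ (fun x => V (Num.min x (- e)) y)).
    move=> x1; have min1 x2 : `|polar (Num.min x2 (- e)) y| <= 1.
      rewrite normc_polar lecR -expR0 ler_expR.
      by apply: le_trans (ltW Ne0); rewrite ge_min lexx orbT.
    have minx1 : Num.min x2 (- e) @[x2 --> x1] --> Num.min x1 (- e).
      by apply: (@continuous_min _ _ id (cst (- e)));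
        [exact: cvg_id|exact: cvg_cst].
    have gx1 := cvg_comp _ _ minx1 (@polar_continuousl y _).
    have Px1 : P (polar (Num.min x2 (- e)) y) @[x2 --> x1] -->
        (P (polar (Num.min x1 (- e)) y) : C^o).
      by apply: (disk_algebra_cvg dP _ gx1) => //; exact: filterE.
    exact: (cvg_comp _ _ Px1 (@Im_continuous _)).
  by rewrite ltrBlDr (le_lt_trans ax)// ltrDl.
have pi2 : 0 <= 2 * pi :> R by rewrite mulr_ge0// ltW.
(* Periodicity: the horizontal sides of the rectangle contribute the same. *)
have VE : FV (2 * pi) = FV 0.
  apply/funext => x; congr (primitive _ _ x); apply/funext => x'.
  rewrite /V; congr (complex.Im (P _)).
  by rewrite /polar -[2 * pi]add0r mulr_natl cosD2pi sinD2pi.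
clearbody FU FV.
have := @curl_free_circulation_eq0 R U V FU FV a (- e) 0 (2 * pi) (ltW ae) pi2.
rewrite VE subrr => circ.
have {}circ : FU (- e) (2 * pi) - FU (- e) 0 = FU a (2 * pi) - FU a 0.
  apply/eqP; rewrite -subr_eq0; apply/eqP; apply: circ.
  - by move=> x y /andP[_ xe] /andP[y0 _]; exact: dU.
  - by move=> x y axe _; exact: dV.
  - move=> x y /andP[ax xe] _.
    have xlt0 := le_lt_trans xe Ne0.
    have [|A [B ABP]] := @derivable_polar_local P x y xlt0.
      by apply: (proj1 dP); rewrite normc_polar ltcR -expR0 ltr_expR.
    exists A, (- B), B => e' /ABP[r' r'0 r'P]; exists r' => // x' y' _ _ xr yr.
    by rewrite mulNr; exact: r'P.
have [y1 y1P E1] := mean_value pi2 (fun y y0 =>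
  dU (- e) y (lexx _) (proj1 (andP y0))).
have [y2 y2P E2] := mean_value pi2 (fun y y0 =>
  dU a y (ltW ae) (proj1 (andP y0))).
move: circ; rewrite E1 E2 subr0 => /mulIf; rewrite mulf_neq0 ?gt_eqF// => /(_ isT).
move=> UE; have := eP y1 y1P; rewrite -/(U _ _) UE ltNge => /negP; apply.
apply: ltW; apply: lt_trans (_ : e / 2 < e); last first.
  by rewrite ltr_pdivrMr// ltr_pMr// ltr1n.
by apply: rP; rewrite normc_polar ltcR.
Qed.

End ComplexTopology.
(** * Smooth families of functions and paths of loops *)

Section SmoothFamilies.
Variable R : realType.
Implicit Types (f g : R -> R -> R) (k : nat) (s t e : R).

(** The functions f s of the angle form a continuous path in the space of bounded
    functions with the uniform norm. *)
Definition bounded_family f : Prop :=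
  (forall s, exists M, forall t, `|f s t| <= M) /\
  (forall s e, 0 < e -> \forall s' \near s, forall t, `|f s' t - f s t| <= e).

(** The first k derivatives in the angle, each of them such a path.  The
    derivative is quantified existentially rather than taken with derive1 so that
    the closure properties below need no computation of higher derivatives. *)
Fixpoint family_of_class k f : Prop :=
  bounded_family f /\
  if k is k'.+1 then exists f',
    (forall s t, is_derive t 1 (f s) (f' s t)) /\ family_of_class k' f'
  else True.

Definition smooth_family f : Prop := forall k, family_of_class k f.

Lemma family_of_class_bounded k f : family_of_class k f -> bounded_family f.
Proof. by case: k => [|k] []. Qed.

Lemma family_of_class_pred k f : family_of_class k.+1 f -> family_of_class k f.
Proof.
elim: k f => [|k IH] f; first by move=> [].
by move=> [bf [f' [df /IH f'k]]]; split=> //; exists f'.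
Qed.

Lemma bounded_familyD f g : bounded_family f -> bounded_family g ->
  bounded_family (fun s t => f s t + g s t).
Proof.
move=> [bf cf] [bg cg]; split=> [s|s e e0].
  have [M fM] := bf s; have [N gN] := bg s; exists (M + N) => t.
  by rewrite (le_trans (ler_normD _ _))// lerD.
have e2 : 0 < e / 2 by rewrite divr_gt0.
apply: filterS2 (cf s _ e2) (cg s _ e2) => s' fs gs t.
rewrite opprD addrACA (le_trans (ler_normD _ _))// [leRHS]splitr.
exact: lerD (fs t) (gs t).
Qed.

Lemma bounded_familyM f g : bounded_family f -> bounded_family g ->
  bounded_family (fun s t => f s t * g s t).
Proof.
move=> [bf cf] [bg cg]; split=> [s|s e e0].
  have [M fM] := bf s; have [N gN] := bg s; exists (M * N) => t.
  by rewrite normrM ler_pM.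
have [M fM] := bf s; have [N gN] := bg s.
have M0 : 0 <= M := le_trans (normr_ge0 _) (fM 0).
have N0 : 0 <= N := le_trans (normr_ge0 _) (gN 0).
pose e' := Num.min 1 (e / (M + N + 1)).
have MN : 0 < M + N + 1 by rewrite ltr_wpDl// addr_ge0.
have e'0 : 0 < e' by rewrite lt_min ltr01 divr_gt0.
have e'1 : e' <= 1 by rewrite ge_min lexx.
have e'e : e' * (M + N + 1) <= e by rewrite -ler_pdivlMr// ge_min lexx orbT.
apply: filterS2 (cf s _ e'0) (cg s _ e'0) => s' fs gs t.
have -> : f s' t * g s' t - f s t * g s t =
  (f s' t - f s t) * (g s' t - g s t) + (f s' t - f s t) * g s t +
    f s t * (g s' t - g s t) by ring.
apply: le_trans e'e.
have b1 : `|(f s' t - f s t) * (g s' t - g s t)| <= e'.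
  rewrite normrM; apply: le_trans (ler_pM _ _ (fs t) (gs t)) _ => //.
  by rewrite ler_piMr// ltW.
have b2 : `|(f s' t - f s t) * g s t| <= e' * N by rewrite normrM ler_pM.
have b3 : `|f s t * (g s' t - g s t)| <= e' * M by rewrite normrM mulrC ler_pM.
apply: le_trans (ler_normD _ _) _.
apply: le_trans (lerD (ler_normD _ _) b3) _.
apply: le_trans (lerD (lerD b1 b2) (lexx _)) _.
by rewrite le_eqVlt; apply/orP; left; apply/eqP; ring.
Qed.

Lemma bounded_familyV f :
  (forall s, exists2 d, 0 < d & forall t, d <= f s t) ->
  bounded_family f -> bounded_family (fun s t => (f s t)^-1).
Proof.
move=> lf [bf cf]; split=> [s|s e e0]; have [d d0 fd] := lf s.
  exists d^-1 => t; have fst0 := lt_le_trans d0 (fd t).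
  by rewrite gtr0_norm ?invr_gt0// lef_pV2// posrE.
have d2 : 0 < d / 2 by rewrite divr_gt0.
have e'0 : 0 < e * (d / 2 * d) by rewrite !mulr_gt0.
apply: filterS2 (cf s _ d2) (cf s _ e'0) => s' fs fs' t.
have fst0 := lt_le_trans d0 (fd t).
have fs't : d / 2 <= f s' t.
  by have := fs t; rewrite ler_norml => /andP[? ?]; have := fd t; lra.
have fs't0 := lt_le_trans d2 fs't.
have -> : (f s' t)^-1 - (f s t)^-1 = (f s t - f s' t) / (f s' t * f s t).
  by field; rewrite !gt_eqF.
rewrite normrM normfV (gtr0_norm (mulr_gt0 fs't0 fst0)).
rewrite ler_pdivrMr ?mulr_gt0// distrC (le_trans (fs' t))//.
by rewrite ler_pM2l// ler_pM// ltW.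
Qed.

Lemma family_of_classD k f g : family_of_class k f -> family_of_class k g ->
  family_of_class k (fun s t => f s t + g s t).
Proof.
elim: k f g => [|k IH] f g [bf df] [bg dg]; split=> //; do ?exact: bounded_familyD.
have [f' [{}df f'k]] := df; have [g' [{}dg g'k]] := dg.
exists (fun s t => f' s t + g' s t); split=> [s t|]; last exact: IH.
exact: is_deriveD.
Qed.

Lemma family_of_classM k f g : family_of_class k f -> family_of_class k g ->
  family_of_class k (fun s t => f s t * g s t).
Proof.
elim: k f g => [|k IH] f g fk gk; have [bf df] := fk; have [bg dg] := gk;
  split=> //; do ?exact: bounded_familyM.
have [f' [{}df f'k]] := df; have [g' [{}dg g'k]] := dg.
exists (fun s t => f s t * g' s t + g s t * f' s t); split=> [s t|].
  exact: (is_deriveM (df s t) (dg s t)).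
by apply: family_of_classD; apply: IH => //; exact: family_of_class_pred.
Qed.

Lemma smooth_family_cst (c : R -> R) : continuous c ->
  smooth_family (fun s _ => c s).
Proof.
have bounded (c' : R -> R) : continuous c' -> bounded_family (fun s _ => c' s).
  move=> cc; split=> [s|s e e0]; first by exists `|c' s|.
  by have /cvgrPdist_le/(_ e e0) := cc s; apply: filterS => s'; rewrite distrC.
move=> cc; elim=> [|k IH]; split=> //; do ?exact: bounded.
exists (fun _ _ => 0); split; first by move=> s t; exact: is_derive_cst.
elim: k {IH} => [|k IH]; split=> //; do ?(apply: bounded; exact: cst_continuous).
by exists (fun _ _ => 0); split=> // s t; exact: is_derive_cst.
Qed.

Lemma smooth_family_id : smooth_family (fun s _ : R => s).
Proof. by apply: (@smooth_family_cst id) => x; exact: cvg_id. Qed.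

Lemma smooth_family_const (a : R) : smooth_family (fun _ _ : R => a).
Proof. by apply: (@smooth_family_cst (cst a)); exact: cst_continuous. Qed.

(** Each of the two functions is, up to sign, the derivative of the other, so both
    statements are proved by one induction. *)
Lemma smooth_family_cos_sin :
  smooth_family (fun _ => cos) /\ smooth_family (fun _ => sin).
Proof.
have bc : bounded_family (fun _ => cos).
  split=> [_|s e e0]; first by exists 1 => t; rewrite ler_norml cos_geN1 cos_le1.
  by apply: filterE => s' t; rewrite subrr normr0 ltW.
have bs : bounded_family (fun _ => sin).
  split=> [_|s e e0]; first by exists 1 => t; rewrite ler_norml sin_geN1 sin_le1.
  by apply: filterE => s' t; rewrite subrr normr0 ltW.
suff H k : family_of_class k (fun _ => cos) /\ family_of_class k (fun _ => sin).
  by split=> k; have [] := H k.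
elim: k => [|k [ck sk]]; split; split=> //.
  exists (fun _ t => - 1 * sin t); split.
    by move=> s t; rewrite mulN1r; exact: is_derive_cos.
  by apply: family_of_classM => //; exact: smooth_family_const.
by exists (fun _ => cos); split=> // s t; exact: is_derive_sin.
Qed.

Lemma smooth_familyD f g : smooth_family f -> smooth_family g ->
  smooth_family (fun s t => f s t + g s t).
Proof. by move=> fs gs k; apply: family_of_classD. Qed.

Lemma smooth_familyM f g : smooth_family f -> smooth_family g ->
  smooth_family (fun s t => f s t * g s t).
Proof. by move=> fs gs k; apply: family_of_classM. Qed.

Lemma smooth_familyN f : smooth_family f -> smooth_family (fun s t => - f s t).
Proof.
move=> fs; under eq_fun do under eq_fun do rewrite -mulN1r.
by apply: smooth_familyM => //; exact: smooth_family_const.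
Qed.

(** The derivative - f' / f^2 of 1 / f involves 1 / f itself only to the previous
    class. *)
Lemma smooth_familyV f :
  (forall s, exists2 d, 0 < d & forall t, d <= f s t) ->
  smooth_family f -> smooth_family (fun s t => (f s t)^-1).
Proof.
move=> lf fs; elim=> [|k IH]; split=> //;
  do ?[apply: bounded_familyV => //; exact: family_of_class_bounded (fs 0)].
have [bf [f' [df f'k]]] := fs k.+1.
exists (fun s t => (-1) * ((f s t)^-1 * (f s t)^-1 * f' s t)).
split=> [s t|].
  have [d d0 fd] := lf s; have f0 : f s t != 0.
    by rewrite gt_eqF// (lt_le_trans d0).
  have := is_deriveV f0 (df s t).
  by rewrite /GRing.scale/= expr2 invfM mulN1r mulNr.
apply: family_of_classM; last by do 2?apply: family_of_classM.
exact: smooth_family_const.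
Qed.

Lemma derive1n_family_of_class k f : family_of_class k f ->
  bounded_family (fun s => derive1n k (f s)).
Proof.
elim: k f => [|k IH] f; first by case.
move=> [_ [f' [df /IH]]]; congr bounded_family; apply/funext => s.
rewrite derive1Sn; congr (derive1n k _); apply/funext => t.
by rewrite derive1E; have [_ ->] := df s t.
Qed.

Lemma smooth_family_smooth f s : smooth_family f -> smooth (f s).
Proof.
move=> fs k; move: (fs k.+1); elim: k f {fs} => [|k IH] f [_ [f' [df f'k]]] t.
  by have [] := df s t.
rewrite derive1Sn (_ : derive1 (f s) = f' s); first exact: IH.
by apply/funext => t'; rewrite derive1E; have [_ ->] := df s t'.
Qed.

Local Open Scope complex_scope.

Definition smooth_loop_family (G : R -> loop R) : Prop := forall i j : 'I_2,
  smooth_family (fun s => re_entry (G s) i j) /\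
  smooth_family (fun s => im_entry (G s) i j).

Lemma smooth_loop_family_smooth G s : smooth_loop_family G -> smooth_loop (G s).
Proof.
move=> sG i j; have [Gr Gi] := sG i j.
by split; [exact: smooth_family_smooth Gr|exact: smooth_family_smooth Gi].
Qed.

(** The space of jets is a product, so one derivative can be treated at a time. *)
Lemma smooth_loop_family_continuous G : smooth_loop_family G ->
  continuous (G : R -> Coo_loop R).
Proof.
move=> sG; apply: continuous_comp_initial => s.
have FG : Filter ((@loop_jet R \o G) @ s) by exact: fmap_filter.
apply/cvg_sup => k B [_ [[W oW <-]]] /= WGs WB; apply: (filterS WB) => {B WB}.
have /uniform_nbhs[E [entE EW]] : nbhs (loop_jet (G s) k) W.
  by apply: open_nbhs_nbhs; split.
move: entE; rewrite -entourage_ballE => -[e /= e0 eE].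
have [r rE] := gt0_complexP e0.
move: e0; rewrite rE ltcR => r0; have r4 : 0 < r / 4 by rewrite divr_gt0.
have H (i j : 'I_2) : \forall s' \near s, forall t,
    `|(derive1n k (re_entry (G s') i j) t +i* derive1n k (im_entry (G s') i j) t) -
      (derive1n k (re_entry (G s) i j) t +i* derive1n k (im_entry (G s) i j) t)|
    < r%:C.
  have [sr si] := sG i j.
  have [_ cr] := derive1n_family_of_class (sr k).
  have [_ ci] := derive1n_family_of_class (si k).
  apply: filterS2 (cr s _ r4) (ci s _ r4) => s' br bi t.
  apply: le_lt_trans (normc_le_ReIm _) _; rewrite ltcR /=.
  by apply: le_lt_trans (lerD (br t) (bi t)) _; lra.
have Fs : Filter (nbhs (s : R)) := nbhs_filter s.
have {}H := filter_forall _ (fun i => filter_forall _ (H i)).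
suff : \forall s' \near s, W (loop_jet (G s') k) by [].
apply: (@filterS _ _ Fs _ _ _ (H Fs Fs)) => {}s' {}H.
apply: EW => t _; apply: eE.
split=> [|i j]; first by rewrite rE ltcR.
by rewrite !mxE; rewrite /ball/= distrC rE; exact: H.
Qed.

Lemma smooth_loop_family_component G s0 s1 : smooth_loop_family G ->
  (forall s z, SU11 (G s z)) ->
  @connected_component (Coo_loop R) (LSU11 R) (G s0) (G s1).
Proof.
move=> sG G11; apply: (@connected_component_max (Coo_loop R) _ (range G)).
- by exists s0.
- by move=> _ [s _ <-]; split; [exact: smooth_loop_family_smooth|exact: G11].
- have R_connected : connected [set: R].
    by apply/connected_intervalP => x y _ _ z _.
  apply: (connected_continuous_connected (U := Coo_loop R) R_connected).
  by apply: continuous_subspaceT; exact: smooth_loop_family_continuous.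
- by exists s1.
Qed.

End SmoothFamilies.
(** * Two paths of loops in SU(1,1) *)

Section LoopsInSU11.
Variable R : realType.
Local Notation C := R[i].
Local Open Scope complex_scope.
Implicit Types (s t : R) (w : C) (z : circle R).

Lemma mx2E (a b c d : C) :
  [/\ mx2 a b c d 0 0 = a, mx2 a b c d 0 1 = b,
      mx2 a b c d 1 0 = c & mx2 a b c d 1 1 = d].
Proof. by rewrite !mxE. Qed.

Lemma ord2P (Q : 'I_2 -> Prop) : Q 0 -> Q 1 -> forall i, Q i.
Proof.
move=> Q0 Q1 i; have [->|->] // : i = 0 \/ i = 1.
by case: i => -[|[|k]] ki; [left; exact: val_inj|right; exact: val_inj|].
Qed.

Lemma eq_mx2 (A B : 'M[C]_2) : A 0 0 = B 0 0 -> A 0 1 = B 0 1 ->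
  A 1 0 = B 1 0 -> A 1 1 = B 1 1 -> A = B.
Proof. by move=> *; apply/matrixP; do 2?apply: ord2P. Qed.

Lemma mul_mx2 (a b c d a' b' c' d' : C) :
  mx2 a b c d *m mx2 a' b' c' d' =
  mx2 (a * a' + b * c') (a * b' + b * d') (c * a' + d * c') (c * b' + d * d').
Proof. by apply: eq_mx2; rewrite !mxE !big_ord_recl big_ord0 !mxE /= addr0. Qed.

Lemma det_2 (A : 'M[C]_2) : \det A = A 0 0 * A 1 1 - A 0 1 * A 1 0.
Proof.
rewrite (expand_det_row _ 0) !big_ord_recl big_ord0 addr0 /cofactor !det_mx11.
rewrite !mxE /= expr0 expr1 mul1r mulN1r mulrN.
by congr (A _ _ * A _ _ - A _ _ * A _ _); exact: val_inj.
Qed.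

Lemma det_mx2 (a b c d : C) : \det (mx2 a b c d) = a * d - b * c.
Proof. by rewrite det_2 !mxE. Qed.

Lemma mx2_1 : mx2 1 0 0 1 = 1%:M :> 'M[C]_2.
Proof. by apply: eq_mx2; rewrite !mxE. Qed.

Lemma mulmx2E (M N : 'M[C]_2) i j :
  (M *m N) i j = M i 0 * N 0 j + M i 1 * N 1 j.
Proof.
rewrite mxE !big_ord_recl big_ord0 addr0 (_ : lift ord0 ord0 = 1)//.
exact: val_inj.
Qed.

Lemma mulmx_adj2 (M : 'M[C]_2) :
  mx2 (M 1 1) (- M 0 1) (- M 1 0) (M 0 0) *m M = (\det M)%:M.
Proof.
rewrite [X in _ *m X](_ : _ = mx2 (M 0 0) (M 0 1) (M 1 0) (M 1 1)); last first.
  by apply: eq_mx2; rewrite mxE.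
by rewrite mul_mx2 det_2; apply: eq_mx2; rewrite !mxE /=; ring.
Qed.

(** With a real constant as off-diagonal entry only the modulus of alpha is
    prescribed: |alpha|^2 = 1 + s^2. *)
Definition sym_loop (alpha : circle R -> C) (s : R) : loop R :=
  fun z => mx2 (alpha z) s%:C s%:C (conjc (alpha z)).

Lemma SU11_det (A : 'M[C]_2) : SU11 A -> \det A = 1.
Proof.
by move=> [a [b [ab ->]]]; rewrite det_mx2 -[RHS]ab !sqr_normc.
Qed.

Lemma sym_loop_SU11 alpha s z :
  complex.Re (alpha z) ^+ 2 + complex.Im (alpha z) ^+ 2 = 1 + s ^+ 2 ->
  SU11 (sym_loop alpha s z).
Proof.
move=> E; exists (alpha z), s%:C; split; last by rewrite /sym_loop conjc_real.
by rewrite -!add_Re2_Im2 E /= expr0n addr0 -rmorphB addrK.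
Qed.

Lemma sym_loop_component (alpha : R -> circle R -> C) s0 s1 :
  smooth_family (fun s t => complex.Re (alpha s (cis t))) ->
  smooth_family (fun s t => complex.Im (alpha s (cis t))) ->
  (forall s z, complex.Re (alpha s z) ^+ 2 + complex.Im (alpha s z) ^+ 2 =
               1 + s ^+ 2) ->
  @connected_component (Coo_loop R) (LSU11 R)
    (sym_loop (alpha s0) s0) (sym_loop (alpha s1) s1).
Proof.
move=> sR sI E; apply: (smooth_loop_family_component
  (G := fun s => sym_loop (alpha s) s)) => [i j|s z]; last exact: sym_loop_SU11.
have idS := @smooth_family_id R; have cst0 := @smooth_family_const R 0.
rewrite /re_entry /im_entry /sym_loop.
move: j; apply: ord2P; move: i; apply: ord2P; split;
  under eq_fun do under eq_fun do rewrite !mxE /= //=; rewrite //.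
- by under eq_fun do under eq_fun do rewrite Re_conj.
- by under eq_fun do under eq_fun do rewrite Im_conj; exact: smooth_familyN.
Qed.

Lemma circleP z : exists x y, val z = x +i* y /\ x ^+ 2 + y ^+ 2 = 1.
Proof.
case: z => -[x y] /= /eqP xy1; exists x, y; split=> //.
by apply/complexI; have := add_Re2_Im2 (x +i* y); rewrite /= xy1 expr1n.
Qed.

Lemma circle_norm z : `|val z| = 1. Proof. by case: z => x /= /eqP. Qed.

Lemma circle_normV z : `|(val z)^-1| = 1.
Proof. by rewrite normfV circle_norm invr1. Qed.

Lemma circle_neq0 z : val z != 0.
Proof. by rewrite -normr_eq0 circle_norm oner_eq0. Qed.

Lemma circle_conj z : conjc (val z) = (val z)^-1.
Proof. by case: z => z /= /eqP z1; rewrite invc_norm z1 expr1n invr1 mul1r. Qed.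

(** The hyperbolic cosine of the number whose hyperbolic sine is s. *)
Definition ch s : R := Num.sqrt (1 + s ^+ 2).

Lemma ch2 s : ch s ^+ 2 = 1 + s ^+ 2.
Proof. by rewrite sqr_sqrtr// addr_ge0// sqr_ge0. Qed.

Lemma ch_gt s : `|s| < ch s.
Proof.
by rewrite -sqrtr_sqr ltr_sqrt ?ltrDr// ltr_pwDl// sqr_ge0.
Qed.

Lemma ch_gt0 s : 0 < ch s.
Proof. exact: le_lt_trans (normr_ge0 s) (ch_gt s). Qed.

Lemma ch0 : ch 0 = 1.
Proof. by rewrite /ch expr0n/= addr0 sqrtr1. Qed.

Local Notation c := ((ch 1)%:C : C).

Lemma sqr_c : c ^+ 2 = 2.
Proof.
by rewrite -(rmorphXn (@real_complex R)) ch2 expr1n;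
  exact: (rmorph_nat (@real_complex R) 2).
Qed.

Lemma chN s : ch (- s) = ch s. Proof. by rewrite /ch sqrrN. Qed.

Lemma smooth_family_ch : smooth_family (fun s _ : R => ch s).
Proof.
apply: smooth_family_cst => s.
have sq : 1 + x ^+ 2 @[x --> s] --> 1 + s ^+ 2.
  by apply: cvgD; [exact: cvg_cst|exact: exprn_continuous].
exact: (cvg_comp _ _ sq (@sqrt_continuous R _)).
Qed.

Definition degree_one_loop s : loop R :=
  sym_loop (fun z => (ch s)%:C * val z) s.

Lemma degree_one_component s : LSU11_component R 1 (degree_one_loop s).
Proof.
rewrite /LSU11_component; have -> : @diag_loop R 1 = degree_one_loop 0.
  apply/funext => z; rewrite /degree_one_loop /sym_loop ch0 /diag_loop mul1r.
  by rewrite expr1z exprN1 circle_conj.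
apply: (sym_loop_component (alpha := fun s z => (ch s)%:C * val z)).
- have [co _] := @smooth_family_cos_sin R.
  under eq_fun do under eq_fun do rewrite /= mul0r subr0.
  exact: smooth_familyM smooth_family_ch co.
- have [_ si] := @smooth_family_cos_sin R.
  under eq_fun do under eq_fun do rewrite /= mul0r addr0.
  exact: smooth_familyM smooth_family_ch si.
- move=> s' z; have [x [y [-> xy]]] := circleP z.
  by rewrite /= !mul0r subr0 addr0 !exprMn -mulrDr xy mulr1 ch2.
Qed.

(** The square |ch s - s z|^2 of a distance, for z on the circle. *)
Definition sqr_dist s z : R :=
  1 + 2 * s ^+ 2 - 2 * s * ch s * complex.Re (val z).

(** On the circle this is ch s (ch s - s z) / (ch s - s / z).  Its winding number is
    0, as |s| < ch s; the denominator is made real so that real and imaginary parts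
    can be read off. *)
Definition degree_zero_entry s z : C :=
  (ch s / sqr_dist s z)%:C * ((ch s)%:C - s%:C * val z) ^+ 2.

Definition degree_zero_loop s : loop R := sym_loop (degree_zero_entry s) s.

Lemma sqr_dist_ge s z : (ch s - `|s|) ^+ 2 <= sqr_dist s z.
Proof.
have [x [y [zE xy]]] := circleP z.
have x1 : `|x| <= 1.
  rewrite -(ler_pXn2r (n := 2)) ?nnegrE// expr1n real_normK ?num_real//.
  by rewrite -xy lerDl sqr_ge0.
have : s * ch s * x <= `|s| * ch s.
  apply: le_trans (ler_norm _) _; rewrite !normrM (ger0_norm (ltW (ch_gt0 s))).
  by rewrite ler_piMr// mulr_ge0// ltW// ch_gt0.
rewrite /sqr_dist zE /= sqrrB ch2 real_normK ?num_real//.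
have := ch_gt0 s; rewrite mulr_natl mulr2n; lra.
Qed.

Lemma sqr_dist_gt0 s z : 0 < sqr_dist s z.
Proof.
apply: lt_le_trans (sqr_dist_ge s z).
by rewrite exprn_gt0// subr_gt0 ch_gt.
Qed.

Lemma degree_zero_component s : LSU11_component R 0 (degree_zero_loop s).
Proof.
rewrite /LSU11_component; have -> : @diag_loop R 0 = degree_zero_loop 0.
  apply/funext => z; rewrite /degree_zero_loop /sym_loop /degree_zero_entry.
  rewrite /sqr_dist ch0 /diag_loop oppr0 expr0z.
  have -> : 1 / (1 + 2 * 0 ^+ 2 - 2 * 0 * 1 * complex.Re (val z)) = 1.
    by rewrite expr0n /= !mulr0 !mul0r addr0 subr0 divr1.
  by rewrite -[0%:C]/(0 : C) -[1%:C]/(1 : C) mul0r subr0 expr1n mulr1 conjc1.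
have [co si] := @smooth_family_cos_sin R.
have chS := smooth_family_ch; have idS := smooth_family_id.
have cstS := smooth_family_const.
have scaleS : smooth_family (fun s t => ch s / sqr_dist s (cis t)).
  apply: smooth_familyM => //; apply: smooth_familyV => [s'|].
    exists ((ch s' - `|s'|) ^+ 2); first by rewrite exprn_gt0// subr_gt0 ch_gt.
    by move=> t; exact: sqr_dist_ge.
  rewrite /sqr_dist /=.
  apply: smooth_familyD; first by apply: smooth_familyD => //; do 2?apply: smooth_familyM.
  by apply: smooth_familyN; do 3?apply: smooth_familyM.
pose p s t := ch s - s * cos t; pose q s t := - (s * sin t).
have pS : smooth_family p.
  by apply: smooth_familyD => //; apply: smooth_familyN; apply: smooth_familyM.
have qS : smooth_family q by apply: smooth_familyN; apply: smooth_familyM.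
have entryE s' (x y : R) z : val z = x +i* y -> degree_zero_entry s' z =
    (ch s' / sqr_dist s' z *
      ((ch s' - s' * x) ^+ 2 - (s' * y) ^+ 2)) +i*
    (ch s' / sqr_dist s' z * (- 2 * (ch s' - s' * x) * (s' * y))).
  move=> zE; rewrite /degree_zero_entry zE; apply/eqP; rewrite eq_complex /=.
  by apply/andP; split; apply/eqP; ring.
have entry_cis s' t : degree_zero_entry s' (cis t) =
    (ch s' / sqr_dist s' (cis t) *
      (p s' t * p s' t - q s' t * q s' t)) +i*
    (ch s' / sqr_dist s' (cis t) * (2 * p s' t * q s' t)).
  rewrite (entryE s' (cos t) (sin t))// /p /q.
  by apply/eqP; rewrite eq_complex /=; apply/andP; split; apply/eqP; ring.
apply: (sym_loop_component (alpha := degree_zero_entry)).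
- under eq_fun do under eq_fun do rewrite entry_cis /=.
  apply: smooth_familyM => //.
  by apply: smooth_familyD; [|apply: smooth_familyN]; apply: smooth_familyM.
- under eq_fun do under eq_fun do rewrite entry_cis /=.
  by apply: smooth_familyM => //; do 2?apply: smooth_familyM.
- move=> s' z; have [x [y [zE xy]]] := circleP z.
  rewrite (entryE s' x y z zE) /=; rewrite -ch2.
  have := sqr_dist_gt0 s' z.
  have : sqr_dist s' z = (ch s' - s' * x) ^+ 2 + (s' * y) ^+ 2.
    rewrite /sqr_dist zE /= exprMn sqrrB ch2.
    have -> : y ^+ 2 = 1 - x ^+ 2 by rewrite -xy addrC addKr.
    by ring.
  move: (sqr_dist _ _) => N NE N0.
  rewrite [X in X + _]exprMn [X in _ + X]exprMn -mulrDr.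
  have -> : ((ch s' - s' * x) ^+ 2 - (s' * y) ^+ 2) ^+ 2 +
     (- 2 * (ch s' - s' * x) * (s' * y)) ^+ 2 = N ^+ 2 by rewrite NE; ring.
  by rewrite -exprMn divfK// gt_eqF.
Qed.

End LoopsInSU11.

(** * A loop of degree one in the stratum of r_1 *)

Section Birkhoff.
Variable R : realType.
Local Notation C := R[i].
Local Notation c := ((ch 1)%:C%C : C).
Local Open Scope complex_scope.
Implicit Types (s t : R) (w : C) (z : circle R).

Lemma disk_map_entries (f : C -> 'M[C]_2) i j :
  disk_map f -> disk_algebra (fun x => f x i j).
Proof.
move=> [_ df cf _]; split=> [x x1|]; first exact: df.
apply/subspace_continuousP => x x1.
have fx : f y @[y --> within (@closed_disk R) (nbhs x)] --> (f x : 'M[C^o]_2).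
  by move/subspace_continuousP: cf; exact.
exact: (cvg_comp _ _ fx (@coord_continuous C 2 2 i j _)).
Qed.

Lemma disk_map_of_entries (f : C -> 'M[C]_2) :
  (forall x, `|x| < 1 -> \det (f x) = 1) ->
  (forall i j, disk_algebra (fun x => f x i j)) ->
  smooth_loop (fun z => f (val z)) -> disk_map f.
Proof.
move=> detf df sf; split=> // [x x1 i j|]; first by have [+ _] := df i j; exact.
apply/subspace_continuousP => x x1 A [P /= Pf PA].
have fij (i j : 'I_2) :
    \forall y \near within (@closed_disk R) (nbhs x), P i j (f y i j).
  have [_ /subspace_continuousP cf] := df i j.
  exact: (cf x x1 _ (Pf i j)).
have Fx : Filter (within (@closed_disk R) (nbhs x)) by exact: within_filter.
have Fij := filter_forall _ (fun i => filter_forall _ (fij i)).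
by apply: (@filterS _ _ Fx _ _ _ (Fij Fx Fx)) => y Py; apply: PA.
Qed.

Lemma disk_map_lower s : disk_map (fun x : C => mx2 1 0 (s%:C * x) 1).
Proof.
apply: disk_map_of_entries => [x _||]; first by rewrite det_mx2 mul0r mulr1 subr0.
  have e0 := disk_algebra_cst (0 : C); have e1 := disk_algebra_cst (1 : C).
  have ex := disk_algebraM (disk_algebra_cst s%:C) (@disk_algebra_id R).
  by apply: ord2P; apply: ord2P; under eq_fun do rewrite !mxE /=.
have [co si] := @smooth_family_cos_sin R.
have cst (a : R) := @smooth_family_const R a.
apply: (@smooth_loop_family_smooth R (fun _ z => mx2 1 0 (s%:C * val z) 1) 0).
rewrite /smooth_loop_family /re_entry /im_entry.
apply: ord2P; apply: ord2P; split;
  under eq_fun do under eq_fun do rewrite !mxE /=; try exact: cst.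
- by under eq_fun do under eq_fun do rewrite mul0r subr0; exact: smooth_familyM.
- by under eq_fun do under eq_fun do rewrite mul0r addr0; exact: smooth_familyM.
Qed.

Lemma LSU11_LSL2C (g : loop R) : LSU11 R g -> LSL2C R g.
Proof. by move=> [sg g11]; split=> // z; exact: SU11_det. Qed.

Lemma component_LSU11 n (g : loop R) : LSU11_component R n g -> LSU11 R g.
Proof. exact: connected_component_sub. Qed.

(** With c = ch 1, clearing the diagonal of [[c z, -1], [-1, c / z]] against its
    off-diagonal entries by a column operation that is polynomial in z and a row
    operation that is polynomial in 1 / z leaves r_1, because c^2 - 1 = 1.  The
    sign of s = - 1 is the one for which no diagonal factor remains. *)
Lemma degree_one_birkhoff : birkhoff (weyl_r1 R) (degree_one_loop (- 1)).
Proof.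
split; first exact/LSU11_LSL2C/component_LSU11/degree_one_component.
exists 0, 1, (fun x => mx2 1 0 (if x is Some x then (- ch 1)%:C * x^-1 else 0) 1),
  1, 1, (fun x => mx2 1 0 ((- ch 1)%:C * x) 1); split.
- congr weyl_class; apply/funext => z.
  by rewrite /weyl_loop diag_loop0 mul1mx expr1.
- split; last by exists 0.
  rewrite /disk_map_infty; set f := (fun x => _).
  suff -> : f = fun x => mx2 1 0 ((- ch 1)%:C * x) 1 by exact: disk_map_lower.
  apply/funext => x; rewrite /f; case: eqVneq => [->|x0]; first by rewrite mulr0.
  by rewrite invrK.
- by rewrite normr1.
- split; first exact: disk_map_lower.
  by exists 0; rewrite mulr0.
- move=> z; rewrite [in (1^-1)%:C]invr1 invr1 -[1%:C]/(1 : C) mx2_1 !mulmx1.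
  have -> : weyl_loop 0 1 z = mx2 0 (-1) 1 0.
    by rewrite /weyl_loop diag_loop0 mul1mx expr1.
  rewrite !mul_mx2 /degree_one_loop /sym_loop chN.
  have cjE : conjc ((ch 1)%:C * val z) = (ch 1)%:C * (val z)^-1.
    by rewrite conjcM conjc_real circle_conj.
  have NE (x : R) : (- x)%:C = - x%:C by exact: (rmorphN (@real_complex R)).
  rewrite cjE !NE -[1%:C]/(1 : C); congr mx2; [by ring|by ring| |by ring].
  transitivity (1 - (ch 1)%:C ^+ 2 * ((val z)^-1 * val z)); last by ring.
  by rewrite mulVf ?circle_neq0// mulr1 sqr_c; ring.
Qed.

Lemma degree_one_birkhoff_SU11 :
  birkhoff_SU11 1 (weyl_r1 R) (degree_one_loop (- 1)).
Proof. by split; [exact: degree_one_birkhoff|exact: degree_one_component]. Qed.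

Lemma not_SU11_rot (e : C) : e ^+ 2 = 1 -> ~ SU11 (e *: Defs.rot R).
Proof.
move=> e2 [a [b [_ /matrixP E]]].
have := E 0 0; have := E 0 1; have := E 1 0; rewrite !mxE /= mulr0 mulrN1 mulr1.
move=> eb be a0; have : `|b| ^+ 2 = -1.
  by rewrite sqr_normc -eb -be mulNr -expr2 e2.
by move=> b2; have := exprn_ge0 2 (normr_ge0 b); rewrite b2 oppr_ge0 ler10.
Qed.

(** The sign relating two representatives of a class is kept as a complex number
    of square 1. *)
Lemma weyl_class_eq (v v' : loop R) : weyl_class v = weyl_class v' ->
  exists2 e : C, e ^+ 2 = 1 & forall z, v z = e *: v' z.
Proof.
move=> E; have : weyl_class v' v by rewrite -E; left.
case=> [->|->]; first by exists 1 => [|z]; rewrite ?expr1n ?scale1r.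
by exists (- 1) => [|z]; rewrite ?sqrrN ?expr1n ?scaleN1r.
Qed.

Lemma r1_not_represented : ~ represented_in_SU11 (weyl_r1 R).
Proof.
move=> [n [eps [/weyl_class_eq[e e2 vE] /(_ (cis 0))]]].
by rewrite vE; exact: not_SU11_rot.
Qed.

(** * A loop of degree zero outside the open stratum *)

Lemma disk_algebra_boundary1 (P : C -> C) : disk_algebra P ->
  (forall x, `|x| < 1 -> P x = 1) -> forall x, `|x| <= 1 -> P x = 1.
Proof.
move=> dP P1 x x1.
have gx : (1 - e)%:C * x @[e --> (0 : R)^'+] --> (x : C^o).
  have : (fun e : R => (1 - e)%:C * x) @ (0 : R)^'+ --> ((1 - 0)%:C * x : C^o).
    have e0 : 1 - e @[e --> (0 : R)^'+] --> (1 - 0 : R).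
      by apply: cvgB; [exact: cvg_cst|exact: cvg_within].
    apply/cvg_complexP; case: x {x1} => a b /=; split.
      apply: cvgB; first by apply: cvgM; [exact: e0|exact: cvg_cst].
      exact: cvg_cst.
    by apply: cvgD; [apply: cvgM; [exact: e0|exact: cvg_cst]|exact: cvg_cst].
  by rewrite subr0 mul1r.
have small : \forall e \near (0 : R)^'+, `|(1 - e)%:C * x| < 1.
  near=> e; have e0 : 0 < e by near: e; exact: nbhs_right_gt.
  have e1 : e < 1 by near: e; apply: nbhs_right_lt.
  have e1' : 0 <= 1 - e by rewrite subr_ge0 ltW.
  rewrite normrM ger0_norm ?ler0c//; apply: le_lt_trans (_ : _ <= (1 - e)%:C) _.
    by rewrite ler_piMr// ler0c.
  by rewrite ltcR ltrBlDr ltrDl.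
have Px : P ((1 - e)%:C * x) @[e --> (0 : R)^'+] --> (P x : C^o).
  apply: (disk_algebra_cvg dP x1 gx).
  by apply: filterS small => e; exact: ltW.
have P1' : P ((1 - e)%:C * x) @[e --> (0 : R)^'+] --> (1 : C^o).
  by move=> A /nbhs_singleton A1; apply: filterS small => e /P1 /= ->.
exact: (cvg_unique (@norm_hausdorff C C^o) Px P1').
Unshelve. all: by end_near. Qed.

Lemma disk_map_det (f : C -> 'M[C]_2) x :
  disk_map f -> `|x| <= 1 -> \det (f x) = 1.
Proof.
move=> df; apply: (disk_algebra_boundary1 (P := fun x => \det (f x))).
  2: by case: df.
under eq_fun do rewrite det_2.
have E i j := disk_map_entries i j df.
by apply: disk_algebraD; [|apply: disk_algebraN]; exact: disk_algebraM.
Qed.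

Lemma c_sub_neq0 (x : C) : `|x| <= 1 -> c - x != 0.
Proof.
move=> x1; rewrite subr_eq0; apply/eqP => cx; move: x1; rewrite -cx.
have -> : `|c| = c by rewrite ger0_norm// ler0c ltW// ch_gt0.
by rewrite lecR leNgt -[X in X < _]normr1 ch_gt.
Qed.

Lemma degree_zero_entry1 z :
  degree_zero_entry 1 z = c * (c - val z) / (c - (val z)^-1).
Proof.
have cz : c - val z != 0 by rewrite c_sub_neq0// circle_norm.
have cx : c - (val z)^-1 != 0 by rewrite c_sub_neq0// circle_normV.
have NE : (sqr_dist 1 z)%:C = (c - val z) * (c - (val z)^-1).
  rewrite /sqr_dist expr1n !mulr1 realcD.
  rewrite (rmorphN (@real_complex R)) -mulrA [X in - X]realcM [X in _ * X]realcM.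
  have E2 : (2 : R)%:C = 2 :> C by exact: (rmorph_nat (@real_complex R) 2).
  have -> : (1 + 2 : R)%:C = 3 :> C by rewrite realcD E2 -[1%:C]/(1 : C); ring.
  have := addcJ (val z); rewrite circle_conj E2 => zE.
  have -> : 2 * (c * (complex.Re (val z))%:C) = c * (2 * (complex.Re (val z))%:C).
    by ring.
  rewrite -zE; transitivity (c ^+ 2 - c * (val z + (val z)^-1) + val z * (val z)^-1).
    by rewrite sqr_c mulfV ?circle_neq0//; ring.
  by ring.
rewrite /degree_zero_entry realcM realcV NE.
rewrite -[1%:C]/(1 : C) mul1r.
move: (c - val z) (c - (val z)^-1) cz cx => p q p0 q0.
by rewrite expr2 invfM -!mulrA [q^-1 * _]mulrCA mulKf// [q^-1 * p]mulrC.
Qed.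

(** The vector (- 1 / (c - z), 1) is holomorphic in the disk, while its image under
    the loop is holomorphic in x = 1/z and vanishes at x = 0. *)
Lemma degree_zero_kernel z : let x := (val z)^-1 in
  let g := degree_zero_loop 1 z in
  g 0 0 * - (c - val z)^-1 + g 0 1 = - (x * (c - x)^-1) /\
  g 1 0 * - (c - val z)^-1 + g 1 1 = - x.
Proof.
move=> x g.
have cz : c - val z != 0 by rewrite c_sub_neq0// circle_norm.
have cx : c - x != 0 by rewrite c_sub_neq0// circle_normV.
have zx : val z * x = 1 by rewrite mulfV ?circle_neq0.
have gE : g = mx2 (c * (c - val z) / (c - x)) 1 1 (c * (c - x) / (c - val z)).
  rewrite /g /degree_zero_loop /sym_loop degree_zero_entry1 -/x; congr mx2.
  have xz : conjc x = val z by rewrite /x -circle_conj conjcK.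
  rewrite !conjcM conjc_inv !conjcB xz circle_conj -/x !conjc_real.
  by [].
rewrite gE; have [-> -> -> ->] := mx2E (c * (c - val z) / (c - x)) 1 1
  (c * (c - x) / (c - val z)); split.
  transitivity ((- c + (c - x)) / (c - x)); last by field.
  by field; rewrite cz cx.
transitivity ((c ^+ 2 - 1 - c * x) / (c - val z)).
  by field; rewrite cz.
rewrite sqr_c; apply: (mulIf cz); rewrite divfK//.
by rewrite mulNr mulrBr [x * val z]mulrC zx; ring.
Qed.

Lemma norm2_eq0 (x : C) :
  complex.Re x ^+ 2 + complex.Im x ^+ 2 = 0 -> x = 0.
Proof.
by move=> x0; apply/eqP; rewrite -normr_eq0 -sqrf_eq0 -add_Re2_Im2 x0.
Qed.

(** A factorization would turn the kernel vector v into a boundary value w = D u v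
    shared by functions holomorphic inside and outside the disk, the outer one h
    vanishing at infinity; A is the adjugate, hence the inverse, of L, and L is
    read in the coordinate 1/z.  Then |w|^2 is the boundary value of P, although
    P 0 = 0 and w does not vanish on the circle. *)
Lemma no_factorization (L u : C -> 'M[C]_2) (D : 'M[C]_2) :
  disk_map L -> disk_map u -> \det D != 0 ->
  ~ (forall z, degree_zero_loop 1 z = L (val z)^-1 *m D *m u (val z)).
Proof.
move=> dL du D0 E.
pose B x := D *m u x.
pose A x := mx2 (L x 1 1) (- L x 0 1) (- L x 1 0) (L x 0 0).
pose w i x := B x i 0 * - (c - x)^-1 + B x i 1.
pose h i x := A x i 0 * - (x * (c - x)^-1) + A x i 1 * - x.
have dcx : disk_algebra (fun x : C => (c - x)^-1).
  apply: disk_algebraV => [x|]; first exact: c_sub_neq0.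
  apply: disk_algebraD; first exact: disk_algebra_cst.
  exact/disk_algebraN/disk_algebra_id.
have du' i j := disk_map_entries i j du.
have dL' i j := disk_map_entries i j dL.
have did := @disk_algebra_id R.
have dB i j : disk_algebra (fun x => B x i j).
  under eq_fun do rewrite /B mulmx2E.
  exact: (disk_algebraD (disk_algebraM (disk_algebra_cst _) (du' _ _))
    (disk_algebraM (disk_algebra_cst _) (du' _ _))).
have dA : forall i j, disk_algebra (fun x => A x i j).
  apply: ord2P; apply: ord2P; under eq_fun do rewrite !mxE /=.
  - exact: (dL' 1 1).
  - exact: (disk_algebraN (dL' 0 1)).
  - exact: (disk_algebraN (dL' 1 0)).
  - exact: (dL' 0 0).
have dw i : disk_algebra (w i).
  exact: (disk_algebraD (disk_algebraM (dB i 0) (disk_algebraN dcx)) (dB i 1)).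
have dh i : disk_algebra (h i).
  exact: (disk_algebraD
    (disk_algebraM (dA i 0) (disk_algebraN (disk_algebraM did dcx)))
    (disk_algebraM (dA i 1) (disk_algebraN did))).
have hw z i : h i (val z)^-1 = w i (val z).
  have [k0 k1] := degree_zero_kernel z.
  rewrite /h -k0 -k1 /w.
  have BE : B (val z) = A (val z)^-1 *m degree_zero_loop 1 z.
    rewrite E !mulmxA mulmx_adj2 (disk_map_det dL) ?circle_normV//.
    by rewrite mul1mx.
  rewrite BE !mulmx2E; move: (A _) (degree_zero_loop 1 z) (- (c - val z)^-1) => a g k.
  by ring.
pose P x := w 0 x * conjc (h 0 (conjc x)) + w 1 x * conjc (h 1 (conjc x)).
have dP : disk_algebra P.
  exact: (disk_algebraD (disk_algebraM (dw 0) (disk_algebra_conj (dh 0)))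
    (disk_algebraM (dw 1) (disk_algebra_conj (dh 1)))).
have := disk_algebra_Re_gt0 dP.
have -> : P 0 = 0.
  by rewrite /P /h conjc0 !mul0r !oppr0 !mulr0 addr0 conjc0 !mulr0 addr0.
rewrite ltxx => contra; suff : false by []; apply: contra => x x1.
have [z zx] : exists z, val z = x by exists (exist _ x (introT eqP x1)).
rewrite -{}zx /P circle_conj !hw -!sqr_normc -!add_Re2_Im2 -realcD /=.
rewrite lt_neqAle !addr_ge0 ?sqr_ge0// andbT eq_sym; apply/negP.
rewrite paddr_eq0 ?addr_ge0 ?sqr_ge0//.
move=> /andP[/eqP/norm2_eq0 w0 /eqP/norm2_eq0 w1].
have detB : \det (B (val z)) = 0.
  move: w0 w1; rewrite det_2 /w; move: (- (c - val z)^-1) => k.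
  move=> /eqP; rewrite addrC addr_eq0 => /eqP ->.
  by move=> /eqP; rewrite addrC addr_eq0 => /eqP ->; ring.
by move: D0; rewrite -[\det D]mulr1 -(disk_map_det (x := val z) du) ?circle_norm//
  -det_mulmx detB eqxx.
Qed.

Lemma degree_zero_not_birkhoff : ~ birkhoff (weyl_one R) (degree_zero_loop 1).
Proof.
rewrite /birkhoff/mkset; case=> _ H; case: H => n [eps [l [m0 [a0 [u H]]]]].
case: H => wE [dl _] [m1 a1] [du _] gE.
have [e e2 eE] := @weyl_class_eq (weyl_loop n eps) (fun=> 1%:M) wE.
have e0 : e != 0 by rewrite -sqrf_eq0 e2 oner_eq0.
have m0' : m0 != 0 by rewrite -normr_eq0 m1 oner_eq0.
have a0' : a0%:C != 0 by rewrite eq_complex /= eqxx andbT gt_eqF.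
pose D := e *: (mx2 m0 0 0 m0^-1 *m mx2 a0%:C 0 0 (a0^-1)%:C).
apply: (no_factorization (D := D) dl du) => [|z].
  rewrite /D detZ e2 mul1r det_mulmx !det_mx2 !mul0r !subr0.
  rewrite mulfV// mul1r realcV mulfV// oner_eq0//.
rewrite gE invr_eq0 (negPf (circle_neq0 z)) invrK eE /D.
by rewrite -!scalemxAr -!scalemxAl mulmx1 !mulmxA.
Qed.

Lemma degree_zero_component_not_birkhoff :
  birkhoff_SU11 0 (weyl_one R) `<` LSU11_component R 0.
Proof.
split=> [g [] //|sub].
by have [/degree_zero_not_birkhoff] := sub _ (degree_zero_component (R := R) 1).
Qed.

End Birkhoff.

Theorem proposition0p1 (R : realType) :
  ((~ (forall (n : int) (w : set (loop R)), affine_weyl R w ->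
         birkhoff_SU11 n w !=set0 -> represented_in_SU11 w)) /\
   (birkhoff_SU11 1 (weyl_r1 R) !=set0 /\ ~ represented_in_SU11 (weyl_r1 R)))
  /\
  birkhoff_SU11 0 (weyl_one R) `<` LSU11_component R 0.
Proof.
have r1_nonempty : birkhoff_SU11 1 (weyl_r1 R) !=set0.
  by exists (degree_one_loop (- 1)); exact: degree_one_birkhoff_SU11.
split; last exact: degree_zero_component_not_birkhoff.
split=> [H|]; last by split=> //; exact: r1_not_represented.
exact: r1_not_represented (H _ _ (weyl_r1_affine R) r1_nonempty).
Qed.
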